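(* Let $X$ be a finite space, $X'$ a ringed finite space, and $\pi\colon X\times X'\to X$ the natural projection. For any quasi-coherent sheaf $\mathcal M$ on $X\times X'$ and any $i\ge0$, the sheaf $R^i\pi_*\mathcal M$ is quasi-coherent.
   Context: All rings are commutative with unit. A ringed finite space is a ringed space $(X,\mathcal O)$ with $X$ a finite topological space. For $p\in X$, $U_p$ is the smallest open subset containing $p$; $p\le q$ means $q\in U_p$. The stalk is $\mathcal O_p=\mathcal O(U_p)$, with restriction morphisms $\mathcal O_p\to\mathcal O_q$ for $p\le q$. A finite space is a ringed finite space all of whose restriction morphisms $\mathcal O_p\to\mathcal O_q$ ($p\le q$) are flat. An $\mathcal O$-module is quasi-coherent if it is locally a cokernel of a morphism between free modules of arbitrary rank. All spaces and morphisms are over a fixed commutative base ring $k$ (i.e. over the one-point ringed space $( *,k)$; $k=\mathbb Z$ imposes no restriction). $X\times X'=X\times_kX'$ is the product topological space with sheaf of rings given by $\mathcal O_{(x,x')}=\mathcal O_x\otimes_k\mathcal O_{x'}$ and the evident restriction morphisms. *)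

(* Defs.v *)
From HB Require Import structures.
From mathcomp Require Import all_boot all_order all_algebra.
From mathcomp Require Import all_classical.
From mathcomp Require Import finmap topology.

Set Implicit Arguments.
Unset Strict Implicit.
Unset Printing Implicit Defensive.

Import GRing.Theory.
Local Open Scope classical_set_scope.
Local Open Scope ring_scope.
Local Open Scope quotient_scope.

Lemma zmod_morphismD (U V : zmodType) (h : U -> V) :
  {morph h : x y / x + y} -> zmod_morphism h.
Proof. by move=> hD x y; rewrite -[in RHS](subrK y x) [in RHS]hD addrK. Qed.

Definition restrict_scalars (R S : pzRingType) (f : {rmorphism R -> S})
  (M : lmodType S) : Type := M.

Section RestrictScalars.
Variables (R S : pzRingType) (f : {rmorphism R -> S}) (M : lmodType S).
Local Notation fM := (restrict_scalars f M).

HB.instance Definition _ := GRing.Zmodule.on fM.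

Definition rs_scale (a : R) (m : fM) : fM := f a *: (m : M).

Lemma rs_scaleA a b m : rs_scale a (rs_scale b m) = rs_scale (a * b) m.
Proof. by rewrite /rs_scale scalerA rmorphM. Qed.
Lemma rs_scale1 : left_id 1 rs_scale.
Proof. by move=> m; rewrite /rs_scale rmorph1 scale1r. Qed.
Lemma rs_scaleDr : right_distributive rs_scale +%R.
Proof. by move=> a m n; rewrite /rs_scale scalerDr. Qed.
Lemma rs_scaleDl m : {morph rs_scale^~ m : a b / a + b}.
Proof. by move=> a b; rewrite /rs_scale rmorphD scalerDl. Qed.

HB.instance Definition _ := GRing.Zmodule_isLmodule.Build R fM
  rs_scaleA rs_scale1 rs_scaleDr rs_scaleDl.
End RestrictScalars.

Definition is_bilinear (R : comPzRingType) (M N P : lmodType R)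
    (b : M -> N -> P) : Prop :=
  [/\ forall m m' n, b (m + m') n = b m n + b m' n,
      forall m n n', b m (n + n') = b m n + b m n',
      forall a m n, b (a *: m) n = a *: b m n &
      forall a m n, b m (a *: n) = a *: b m n].

Section Tensor.
Variables (R : comPzRingType) (M N : lmodType R).

Definition tens_sum (P : lmodType R) (b : M -> N -> P) (l : seq (M * N)) : P :=
  \sum_(p <- l) b p.1 p.2.

(* A list [(m_1, n_1); ...; (m_r, n_r)] stands for the sum of the m_i (x) n_i;
   two such sums are equal in the tensor product iff all bilinear maps agree
   on them. *)
Definition tens_rel (l l' : seq (M * N)) : bool :=
  `[< forall (P : lmodType R) (b : M -> N -> P), is_bilinear b ->
      tens_sum b l = tens_sum b l' >].

Lemma tens_rel_refl : reflexive tens_rel.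
Proof. by move=> l; apply/asboolP. Qed.
Lemma tens_rel_sym : symmetric tens_rel.
Proof.
by move=> l l'; apply/asboolP/asboolP => h P b hb; rewrite h.
Qed.
Lemma tens_rel_trans : transitive tens_rel.
Proof.
by move=> l2 l1 l3 /asboolP h /asboolP h'; apply/asboolP => P b hb; rewrite h // h'.
Qed.

Canonical tens_equiv := EquivRel tens_rel tens_rel_refl tens_rel_sym tens_rel_trans.

Definition tens := {eq_quot tens_equiv}.
HB.instance Definition _ := Choice.on tens.
HB.instance Definition _ := EqQuotient.on tens.

Definition pure (m : M) (n : N) : tens := \pi_tens [:: (m, n)].

(* Meaningful only when b is bilinear; see tens_lift_pure. *)
Definition tens_lift (P : lmodType R) (b : M -> N -> P) (t : tens) : P :=
  tens_sum b (repr t).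

Lemma tens_liftE (P : lmodType R) (b : M -> N -> P) l :
  is_bilinear b -> tens_lift b (\pi_tens l) = tens_sum b l.
Proof.
move=> hb; rewrite /tens_lift.
have /asboolP h : tens_rel (repr (\pi_tens l)) l.
  by apply/eqquotP; exact: reprK.
exact: h.
Qed.

Lemma tens_lift_pure (P : lmodType R) (b : M -> N -> P) m n :
  is_bilinear b -> tens_lift b (pure m n) = b m n.
Proof. by move=> hb; rewrite tens_liftE // /tens_sum big_seq1. Qed.

Lemma tens_ext (s t : tens) :
  (forall (P : lmodType R) (b : M -> N -> P), is_bilinear b ->
     tens_lift b s = tens_lift b t) -> s = t.
Proof.
move=> h; rewrite -[s]reprK -[t]reprK; apply/eqquotP/asboolP => P b hb.
exact: h.
Qed.

Definition tens_zero : tens := \pi_tens [::].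
Definition tens_add (s t : tens) : tens := \pi_tens (repr s ++ repr t).
Definition tens_scale (a : R) (t : tens) : tens :=
  \pi_tens [seq (a *: p.1, p.2) | p <- repr t].
Definition tens_opp (t : tens) : tens := tens_scale (- 1) t.

Section Lift.
Variables (P : lmodType R) (b : M -> N -> P) (hb : is_bilinear b).
Lemma tens_lift0 : tens_lift b tens_zero = 0.
Proof. by rewrite tens_liftE // /tens_sum big_nil. Qed.
Lemma tens_liftD s t :
  tens_lift b (tens_add s t) = tens_lift b s + tens_lift b t.
Proof. by rewrite tens_liftE // /tens_sum big_cat. Qed.
Lemma tens_liftZ a t : tens_lift b (tens_scale a t) = a *: tens_lift b t.
Proof.
rewrite tens_liftE // /tens_sum big_map scaler_sumr.
by apply: eq_bigr => p _; case: hb => _ _ -> _.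
Qed.
End Lift.

Lemma tens_addA : associative tens_add.
Proof. by move=> x y z; apply: tens_ext => P b hb; rewrite !tens_liftD ?addrA. Qed.
Lemma tens_addC : commutative tens_add.
Proof. by move=> x y; apply: tens_ext => P b hb; rewrite !tens_liftD // addrC. Qed.
Lemma tens_add0 : left_id tens_zero tens_add.
Proof. by move=> x; apply: tens_ext => P b hb; rewrite tens_liftD ?tens_lift0 ?add0r. Qed.
Lemma tens_addN : left_inverse tens_zero tens_opp tens_add.
Proof.
move=> x; apply: tens_ext => P b hb.
by rewrite tens_liftD ?tens_lift0 ?tens_liftZ // scaleN1r addNr.
Qed.
HB.instance Definition _ := GRing.isZmodule.Build tens
  tens_addA tens_addC tens_add0 tens_addN.

Lemma tens_scaleA a c t : tens_scale a (tens_scale c t) = tens_scale (a * c) t.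
Proof. by apply: tens_ext => P b hb; rewrite !tens_liftZ ?scalerA. Qed.
Lemma tens_scale1 : left_id 1 tens_scale.
Proof. by move=> t; apply: tens_ext => P b hb; rewrite tens_liftZ ?scale1r. Qed.
Lemma tens_scaleDr : right_distributive tens_scale +%R.
Proof.
move=> a s t; apply: tens_ext => P b hb.
by rewrite tens_liftZ // tens_liftD // scalerDr tens_liftD // !tens_liftZ.
Qed.
Lemma tens_scaleDl t : {morph tens_scale^~ t : a b / a + b}.
Proof.
move=> a c; apply: tens_ext => P b hb.
by rewrite tens_liftZ // tens_liftD // !tens_liftZ // scalerDl.
Qed.
HB.instance Definition _ := GRing.Zmodule_isLmodule.Build R tens
  tens_scaleA tens_scale1 tens_scaleDr tens_scaleDl.

Lemma pure_bilinear : is_bilinear pure.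
Proof.
split=> [m m' n|m n n'|a m n|a m n]; apply: tens_ext => P b hb;
  rewrite ?tens_liftD ?tens_liftZ ?tens_lift_pure //; by case: hb.
Qed.

Lemma tens_lift_linear (P : lmodType R) (b : M -> N -> P) :
  is_bilinear b -> linear (tens_lift b).
Proof. by move=> hb a s t; rewrite tens_liftD // tens_liftZ. Qed.

Lemma tens_sum_pure (t : tens) : t = \sum_(p <- repr t) pure p.1 p.2.
Proof.
apply: tens_ext => P b hb.
pose L := GRing.isLinear.Build R tens P *:%R _ (tens_lift_linear hb).
pose F : {linear tens -> P} := HB.pack (tens_lift b) L.
rewrite [RHS](raddf_sum F) /=.
by apply: eq_bigr => p _; rewrite tens_lift_pure.
Qed.

Lemma tens_lift_unique (P : lmodType R) (b : M -> N -> P) (u : {linear tens -> P}) :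
  is_bilinear b -> (forall m n, u (pure m n) = b m n) -> u =1 tens_lift b.
Proof.
move=> hb hu t; rewrite {1}[t]tens_sum_pure raddf_sum.
by apply: eq_bigr => p _; exact: hu.
Qed.

End Tensor.

Definition tens_map (R : comPzRingType) (M M' N N' : lmodType R)
    (u : M -> M') (v : N -> N') (t : tens M N) : tens M' N' :=
  tens_lift (fun m n => pure (u m) (v n)) t.

Lemma tens_map_bilinear (R : comPzRingType) (M M' N N' : lmodType R)
    (u : M -> M') (v : N -> N') : linear u -> linear v ->
  is_bilinear (fun m n => pure (u m) (v n)).
Proof.
move=> hu hv; case: (pure_bilinear M' N') => h1 h2 h3 h4.
have uD m m' : u (m + m') = u m + u m' by rewrite -[m in LHS]scale1r hu scale1r.
have vD m m' : v (m + m') = v m + v m' by rewrite -[m in LHS]scale1r hv scale1r.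
have u0 : u 0 = 0 by apply: (addrI (u 0)); rewrite -uD !addr0.
have v0 : v 0 = 0 by apply: (addrI (v 0)); rewrite -vD !addr0.
split=> [m m' n|m n n'|a m n|a m n].
- by rewrite uD h1.
- by rewrite vD h2.
- by rewrite -[a *: m]addr0 hu u0 addr0 h3.
- by rewrite -[a *: n]addr0 hv v0 addr0 h4.
Qed.

Definition flat (R S : comPzRingType) (f : {rmorphism R -> S}) : Prop :=
  forall (N N' : lmodType R) (u : {linear N -> N'}), injective u ->
    injective (tens_map (M := restrict_scalars f S^o) idfun u).

Section TensorAlgebra.
Variables (k A B : comPzRingType).
Variables (f : {rmorphism k -> A}) (g : {rmorphism k -> B}).
Local Notation MA := (restrict_scalars f A^o).
Local Notation MB := (restrict_scalars g B^o).

Definition tensalg : Type := tens MA MB.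
HB.instance Definition _ := GRing.Zmodule.on tensalg.

Definition purea (a : A) (b : B) : tensalg := @pure k MA MB a b.

Definition ta_one : tensalg := purea 1 1.

Definition ta_mul (s t : tensalg) : tensalg :=
  @tens_lift k MA MB (tens MA MB) (fun (a : A) (b : B) =>
    @tens_lift k MA MB (tens MA MB) (fun (a' : A) (b' : B) =>
      purea (a * a') (b * b')) t) s.

Section Lift.
Variables (P : lmodType k) (b : MA -> MB -> P) (hb : is_bilinear b).

Lemma mul_bilinear (x : A) (y : B) :
  is_bilinear (fun (m : MA) (n : MB) => b (x * (m : A)) (y * (n : B))).
Proof.
case: hb => h1 h2 h3 h4; split => [m m' n|m n n'|a m n|a m n].
- by rewrite -h1 mulrDr.
- by rewrite -h2 mulrDr.
- by rewrite -h3; congr (b _ _); exact: mulrCA.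
- by rewrite -h4; congr (b _ _); exact: mulrCA.
Qed.

Lemma lift_mul_bilinear (t : tensalg) : is_bilinear (fun (x : MA) (y : MB) =>
  tens_lift (fun (m : MA) (n : MB) => b ((x : A) * (m : A)) ((y : B) * (n : B))) t).
Proof.
case: hb => h1 h2 h3 h4; rewrite /tens_lift /tens_sum.
split => [m m' n|m n n'|a m n|a m n].
- by rewrite -big_split; apply: eq_bigr => p _ /=; rewrite mulrDl h1.
- by rewrite -big_split; apply: eq_bigr => p _ /=; rewrite mulrDl h2.
- rewrite scaler_sumr; apply: eq_bigr => p _ /=; rewrite -h3.
  by congr (b _ _); rewrite -[LHS]mulrA.
- rewrite scaler_sumr; apply: eq_bigr => p _ /=; rewrite -h4.
  by congr (b _ _); rewrite -[LHS]mulrA.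
Qed.
End Lift.

Lemma ta_lift_mul (P : lmodType k) (b : MA -> MB -> P) (s t : tensalg) :
  is_bilinear b ->
  tens_lift b (ta_mul s t : tens MA MB) =
  tens_lift (fun (x : MA) (y : MB) => tens_lift (fun (m : MA) (n : MB) =>
    b ((x : A) * (m : A)) ((y : B) * (n : B))) t) s.
Proof.
move=> hb.
pose F : {linear tens MA MB -> P} := HB.pack (tens_lift b)
  (GRing.isLinear.Build k (tens MA MB) P *:%R _ (tens_lift_linear hb)).
rewrite /ta_mul {2}/tens_lift /tens_sum [LHS](raddf_sum F).
apply: eq_bigr => p _; rewrite {1}/tens_lift /tens_sum (raddf_sum F).
by apply: eq_bigr => q _; rewrite /F /= tens_lift_pure.
Qed.

Lemma tens_lift_eq (P : lmodType k) (b b' : MA -> MB -> P) (t : tens MA MB) :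
  (forall m n, b m n = b' m n) -> tens_lift b t = tens_lift b' t.
Proof. by move=> h; apply: eq_bigr => p _; rewrite h. Qed.

Lemma ta_mulA : associative ta_mul.
Proof.
move=> x y z; apply: tens_ext => P b hb; rewrite !ta_lift_mul //; last first.
  exact: lift_mul_bilinear.
apply: tens_lift_eq => a c; rewrite ta_lift_mul; last exact: mul_bilinear.
apply: tens_lift_eq => a' c'; apply: tens_lift_eq => a'' c''.
by rewrite !mulrA.
Qed.

Lemma ta_mulC : commutative ta_mul.
Proof.
move=> x y; apply: tens_ext => P b hb; rewrite !ta_lift_mul //.
rewrite /tens_lift /tens_sum exchange_big.
by apply: eq_bigr => p _; apply: eq_bigr => q _; rewrite mulrC [X in b _ X]mulrC.
Qed.

Lemma ta_mul1 : left_id ta_one ta_mul.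
Proof.
move=> x; apply: tens_ext => P b hb; rewrite ta_lift_mul // tens_lift_pure.
  by apply: tens_lift_eq => m n; rewrite !mul1r.
exact: lift_mul_bilinear.
Qed.

Lemma ta_mulDl : left_distributive ta_mul +%R.
Proof.
move=> x y z; apply: tens_ext => P b hb.
rewrite [RHS](tens_liftD hb) !ta_lift_mul // [LHS]tens_liftD //.
exact: lift_mul_bilinear.
Qed.

HB.instance Definition _ := GRing.Zmodule_isComPzRing.Build tensalg
  ta_mulA ta_mulC ta_mul1 ta_mulDl.

Lemma purea1 : purea 1 1 = 1. Proof. by []. Qed.
Lemma pureaM a a' b b' : purea a b * purea a' b' = purea (a * a') (b * b').
Proof.
apply: tens_ext => P c hc; rewrite ta_lift_mul // !tens_lift_pure //.
- exact: mul_bilinear.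
- exact: lift_mul_bilinear.
Qed.
Lemma purea_bilinear : is_bilinear (purea : MA -> MB -> tens MA MB).
Proof. exact: pure_bilinear. Qed.

Lemma pureaDl a a' b : purea (a + a') b = purea a b + purea a' b.
Proof. by case: purea_bilinear => + _ _ _; exact. Qed.
Lemma pureaDr a b b' : purea a (b + b') = purea a b + purea a b'.
Proof. by case: purea_bilinear => _ + _ _; exact. Qed.
Lemma pureaZ c a b : purea (f c * a) b = purea a (g c * b).
Proof. by case: purea_bilinear => _ _ h3 h4; rewrite [LHS](h3 c) -h4. Qed.
Lemma purea_sum (t : tensalg) :
  t = \sum_(p <- repr (t : tens MA MB)) purea p.1 p.2.
Proof. exact: (tens_sum_pure (t : tens MA MB)). Qed.

Lemma tensalg_ext (V : zmodType) (h h' : {additive tensalg -> V}) :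
  (forall a b, h (purea a b) = h' (purea a b)) -> h =1 h'.
Proof.
by move=> e t; rewrite (purea_sum t) !raddf_sum; apply: eq_bigr => p _; exact: e.
Qed.

Definition ta_inl (a : A) : tensalg := purea a 1.

Lemma ta_inl_is_zmod_morphism : zmod_morphism ta_inl.
Proof. by apply: zmod_morphismD => a a'; exact: pureaDl. Qed.
Lemma ta_inl_is_monoid_morphism : monoid_morphism ta_inl.
Proof. by split=> // a a'; rewrite /ta_inl pureaM mulr1. Qed.
HB.instance Definition _ :=
  GRing.isZmodMorphism.Build A tensalg ta_inl ta_inl_is_zmod_morphism.
HB.instance Definition _ :=
  GRing.isMonoidMorphism.Build A tensalg ta_inl ta_inl_is_monoid_morphism.
End TensorAlgebra.

Section TensorAlgebraMap.
Variables (k A B A' B' : comPzRingType).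
Variables (f : {rmorphism k -> A}) (g : {rmorphism k -> B}).
Variables (f' : {rmorphism k -> A'}) (g' : {rmorphism k -> B'}).
Variables (u : {rmorphism A -> A'}) (v : {rmorphism B -> B'}).
Hypothesis uf : forall c, u (f c) = f' c.
Hypothesis vg : forall c, v (g c) = g' c.
Local Notation MA := (restrict_scalars f A^o).
Local Notation MB := (restrict_scalars g B^o).
Local Notation MA' := (restrict_scalars f' A'^o).
Local Notation MB' := (restrict_scalars g' B'^o).

Let phi (t : tensalg f g) : tensalg f' g' :=
  @tens_map k MA MA' MB MB' u v t.

Let bil : is_bilinear
  (fun (m : MA) (n : MB) => purea f' g' (u m) (v n) : tens MA' MB').
Proof.
apply: (@tens_map_bilinear k MA MA' MB MB' u v) => a m n /=.
- by rewrite [LHS]rmorphD [in LHS]rmorphM uf.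
- by rewrite [LHS]rmorphD [in LHS]rmorphM vg.
Qed.

Let phi_pure a b : phi (purea f g a b) = purea f' g' (u a) (v b).
Proof. exact: (tens_lift_pure (a : MA) (b : MB) bil). Qed.

Let phi_is_zmod_morphism : zmod_morphism phi.
Proof. by apply: zmod_morphismD => s t; exact: (tens_liftD bil). Qed.
HB.instance Definition _ :=
  GRing.isZmodMorphism.Build (tensalg f g) (tensalg f' g') phi phi_is_zmod_morphism.

Let phi_is_monoid_morphism : monoid_morphism phi.
Proof.
split=> [|s t]; first by rewrite -(purea1 f g) phi_pure !rmorph1.
rewrite (purea_sum s) (purea_sum t) mulr_suml !raddf_sum mulr_suml.
apply: eq_bigr => p _; rewrite mulr_sumr !raddf_sum mulr_sumr.
apply: eq_bigr => q _.
by rewrite pureaM /= !phi_pure pureaM !rmorphM.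
Qed.
HB.instance Definition _ :=
  GRing.isMonoidMorphism.Build (tensalg f g) (tensalg f' g') phi
    phi_is_monoid_morphism.

Definition tensalg_map : {rmorphism tensalg f g -> tensalg f' g'} := phi.

Lemma tensalg_map_pure a b :
  tensalg_map (purea f g a b) = purea f' g' (u a) (v b).
Proof. exact: phi_pure. Qed.
End TensorAlgebraMap.


Lemma tensalg_map_id (k A B : comPzRingType)
    (f : {rmorphism k -> A}) (g : {rmorphism k -> B})
    (u : {rmorphism A -> A}) (v : {rmorphism B -> B})
    (uf : forall c, u (f c) = f c) (vg : forall c, v (g c) = g c) :
  (forall a, u a = a) -> (forall b, v b = b) ->
  forall t : tensalg f g, tensalg_map uf vg t = t.
Proof.
move=> hu hv; apply: (tensalg_ext (h := tensalg_map uf vg) (h' := idfun)) => a b.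
by rewrite [LHS]tensalg_map_pure hu hv.
Qed.

Lemma tensalg_map_comp (k A A' A'' B B' B'' : comPzRingType)
    (f : {rmorphism k -> A}) (f' : {rmorphism k -> A'}) (f'' : {rmorphism k -> A''})
    (g : {rmorphism k -> B}) (g' : {rmorphism k -> B'}) (g'' : {rmorphism k -> B''})
    (u : {rmorphism A -> A'}) (u' : {rmorphism A' -> A''}) (u'' : {rmorphism A -> A''})
    (v : {rmorphism B -> B'}) (v' : {rmorphism B' -> B''}) (v'' : {rmorphism B -> B''})
    (uf : forall c, u (f c) = f' c) (vg : forall c, v (g c) = g' c)
    (uf' : forall c, u' (f' c) = f'' c) (vg' : forall c, v' (g' c) = g'' c)
    (uf'' : forall c, u'' (f c) = f'' c) (vg'' : forall c, v'' (g c) = g'' c) :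
  (forall a, u' (u a) = u'' a) -> (forall b, v' (v b) = v'' b) ->
  forall t : tensalg f g,
    tensalg_map uf' vg' (tensalg_map uf vg t) = tensalg_map uf'' vg'' t.
Proof.
move=> hu hv; apply: (tensalg_ext (h := tensalg_map uf' vg' \o tensalg_map uf vg)
  (h' := tensalg_map uf'' vg'')) => a b.
rewrite -[LHS]/(tensalg_map uf' vg' (tensalg_map uf vg (purea f g a b))).
rewrite !tensalg_map_pure hu hv; exact/esym/tensalg_map_pure.
Qed.

Record opens (X : topologicalType) := Opens {
  oset :> set X;
  _ : open oset }.

Lemma oset_open (X : topologicalType) (U : opens X) : open U.
Proof. by case: U. Qed.

Definition oT (X : topologicalType) : opens X := Opens (@openT X).

Definition opre (X Y : topologicalType) (f : X -> Y) (cf : continuous f)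
    (V : opens Y) : opens X :=
  Opens (open_comp (fun x _ => cf x) (oset_open V)).

Definition is_sheaf (X : topologicalType) (F : opens X -> Type)
    (res : forall U V : opens X, V `<=` U -> F U -> F V) : Prop :=
  forall (U : opens X) (I : Type) (V : I -> opens X) (VU : forall i, V i `<=` U),
    (forall x, oset U x -> exists i, oset (V i) x) ->
  forall s : forall i, F (V i),
    (forall i j (W : opens X) (hi : W `<=` V i) (hj : W `<=` V j),
       res _ _ hi (s i) = res _ _ hj (s j)) ->
  exists! t : F U, forall i, res _ _ (VU i) t = s i.

(* comPzRingType includes the zero ring, which is the ring of sections over the
   empty set. *)
Record ringedSpace := RingedSpace {
  rs_space :> topologicalType;
  rs_sec : opens rs_space -> comPzRingType;
  rs_res : forall U V : opens rs_space, V `<=` U -> {rmorphism rs_sec U -> rs_sec V};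
  rs_res_id : forall (U : opens rs_space) (h : U `<=` U) s, rs_res h s = s;
  rs_res_comp : forall (U V W : opens rs_space)
    (hVU : V `<=` U) (hWV : W `<=` V) (hWU : W `<=` U) s,
    rs_res hWV (rs_res hVU s) = rs_res hWU s;
  rs_sheaf : is_sheaf (fun U V (h : V `<=` U) => rs_res h : rs_sec U -> rs_sec V) }.

Arguments rs_sec : clear implicits.

Record ringedMorphism (X Y : ringedSpace) := RingedMorphism {
  rm_fun :> X -> Y;
  rm_continuous : continuous rm_fun;
  rm_sharp : forall V : opens Y,
    {rmorphism rs_sec Y V -> rs_sec X (opre rm_continuous V)};
  rm_natural : forall (V W : opens Y) (h : W `<=` V)
    (h' : opre rm_continuous W `<=` opre rm_continuous V) s,
    rs_res h' (rm_sharp V s) = rm_sharp W (rs_res h s) }.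

Arguments rm_continuous {X Y} r : rename.

Record modSheaf (X : ringedSpace) := ModSheaf {
  ms_sec :> forall U : opens X, lmodType (rs_sec X U);
  ms_res : forall U V : opens X, V `<=` U -> ms_sec U -> ms_sec V;
  ms_resD : forall (U V : opens X) (h : V `<=` U), {morph ms_res h : s t / s + t};
  ms_resZ : forall (U V : opens X) (h : V `<=` U) (a : rs_sec X U) (s : ms_sec U),
    ms_res h (a *: s) = rs_res h a *: ms_res h s;
  ms_res_id : forall (U : opens X) (h : U `<=` U) s, ms_res h s = s;
  ms_res_comp : forall (U V W : opens X)
    (hVU : V `<=` U) (hWV : W `<=` V) (hWU : W `<=` U) s,
    ms_res hWV (ms_res hVU s) = ms_res hWU s;
  ms_sheaf : is_sheaf ms_res }.

(* Morphisms F|_U -> G|_U. The restriction of a sheaf to U is not built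
   separately: its sections over V `<=` U are those of the sheaf itself. *)
Record modHom_on (X : ringedSpace) (U : opens X) (F G : modSheaf X) := ModHom {
  mh_fun :> forall V : opens X, V `<=` U -> {linear F V -> G V};
  mh_natural : forall (V W : opens X) (hVU : V `<=` U) (hWU : W `<=` U)
    (hWV : W `<=` V) s,
    ms_res hWV (mh_fun hVU s) = mh_fun hWU (ms_res hWV s) }.

Notation modHom := (modHom_on (oT _)).

Section Exactness.
Variables (X : ringedSpace) (U : opens X).
Implicit Types F G H : modSheaf X.

Definition monic_on F G (u : modHom_on U F G) : Prop :=
  forall (V : opens X) (hV : V `<=` U), injective (u V hV).

(* t belongs to the image sheaf of u, i.e. it lifts locally along u. *)
Definition in_image F G (u : modHom_on U F G) (V : opens X) (t : G V) : Prop :=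
  forall x, oset V x -> exists (W : opens X) (hWV : W `<=` V) (hWU : W `<=` U),
    oset W x /\ exists s : F W, u W hWU s = ms_res hWV t.

Definition epi_on F G (u : modHom_on U F G) : Prop :=
  forall V : opens X, V `<=` U -> forall t : G V, in_image u t.

Definition exact_on F G H (u : modHom_on U F G) (v : modHom_on U G H) : Prop :=
  forall (V : opens X) (hV : V `<=` U) (t : G V), v V hV t = 0 <-> in_image u t.
End Exactness.

Section FreeSheaf.
Variables (X : ringedSpace) (I : Type).

Definition locally_finite (U : opens X) (s : I -> rs_sec X U) : Prop :=
  forall x, oset U x -> exists (W : opens X) (hW : W `<=` U),
    oset W x /\ finite_set [set i | rs_res hW (s i) != 0].

(* The direct sum of copies of the structure sheaf indexed by I, in the category
   of sheaves: its sections are the families of finite support locally. *)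
Record freeSec (U : opens X) := FreeSec {
  fs_coef :> I -> rs_sec X U;
  fs_finite : locally_finite fs_coef }.

HB.instance Definition _ U := gen_eqMixin (freeSec U).
HB.instance Definition _ U := gen_choiceMixin (freeSec U).

Lemma freeSecP U (s t : freeSec U) : s =1 t -> s = t.
Proof.
case: s t => s hs [t ht] /= /funext st; case: _ / st ht => ht.
by congr FreeSec; exact: Prop_irrelevance.
Qed.

Section Ops.
Variable U : opens X.
Implicit Types s t : freeSec U.

Lemma fs_zero_subproof : locally_finite (fun=> 0 : rs_sec X U).
Proof.
move=> x Ux; exists U, (@subset_refl _ U); split => //.
rewrite (_ : mkset _ = set0) //.
by apply/seteqP; split => // i /=; rewrite rmorph0 eqxx.
Qed.
Definition fs_zero := FreeSec fs_zero_subproof.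

Lemma fs_add_subproof s t : locally_finite (fun i => s i + t i).
Proof.
move=> x Ux; have [W [hW [Wx fW]]] := fs_finite s Ux.
have [W' [hW' [Wx' fW']]] := fs_finite t Ux.
pose V := Opens (openI (oset_open W) (oset_open W')).
have VU : V `<=` U by move=> y [/hW].
have VW : V `<=` W by move=> y [].
have VW' : V `<=` W' by move=> y [].
exists V, VU; split => //.
apply: (@sub_finite_set _ _ ([set i | rs_res hW (s i) != 0] `|`
  [set i | rs_res hW' (t i) != 0])); last by rewrite finite_setU.
move=> i /=; apply: contraPP => /not_orP[/negP/negPn/eqP si /negP/negPn/eqP ti].
apply/negP/negPn; rewrite rmorphD.
rewrite -(rs_res_comp hW VW VU) -(rs_res_comp hW' VW' VU) si ti.
by rewrite !rmorph0 addr0.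
Qed.
Definition fs_add s t := FreeSec (@fs_add_subproof s t).

Lemma fs_scale_subproof a s : locally_finite (fun i => a * s i).
Proof.
move=> x Ux; have [W [hW [Wx fW]]] := fs_finite s Ux.
exists W, hW; split => //; apply: sub_finite_set fW => i /=.
by apply: contraNN => /eqP e; rewrite rmorphM e mulr0.
Qed.
Definition fs_scale a s := FreeSec (@fs_scale_subproof a s).
Definition fs_opp s := fs_scale (- 1) s.

Lemma fs_addA : associative fs_add.
Proof. by move=> x y z; apply: freeSecP => i /=; rewrite addrA. Qed.
Lemma fs_addC : commutative fs_add.
Proof. by move=> x y; apply: freeSecP => i /=; rewrite addrC. Qed.
Lemma fs_add0 : left_id fs_zero fs_add.
Proof. by move=> x; apply: freeSecP => i /=; rewrite add0r. Qed.
Lemma fs_addN : left_inverse fs_zero fs_opp fs_add.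
Proof. by move=> x; apply: freeSecP => i /=; rewrite mulN1r addNr. Qed.
HB.instance Definition _ := GRing.isZmodule.Build (freeSec U)
  fs_addA fs_addC fs_add0 fs_addN.

Lemma fs_scaleA a b s : fs_scale a (fs_scale b s) = fs_scale (a * b) s.
Proof. by apply: freeSecP => i /=; rewrite mulrA. Qed.
Lemma fs_scale1 : left_id 1 fs_scale.
Proof. by move=> s; apply: freeSecP => i /=; rewrite mul1r. Qed.
Lemma fs_scaleDr : right_distributive fs_scale +%R.
Proof. by move=> a s t; apply: freeSecP => i /=; rewrite mulrDr. Qed.
Lemma fs_scaleDl s : {morph fs_scale^~ s : a b / a + b}.
Proof. by move=> a b; apply: freeSecP => i /=; rewrite mulrDl. Qed.
HB.instance Definition _ := GRing.Zmodule_isLmodule.Build (rs_sec X U) (freeSec U)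
  fs_scaleA fs_scale1 fs_scaleDr fs_scaleDl.
End Ops.

Lemma fs_res_subproof (U V : opens X) (h : V `<=` U) (s : freeSec U) :
  locally_finite (fun i => rs_res h (s i)).
Proof.
move=> x Vx; have [W [hW [Wx fW]]] := fs_finite s (h x Vx).
pose W' := Opens (openI (oset_open W) (oset_open V)).
have hWV : W' `<=` V by move=> y [].
have hWW : W' `<=` W by move=> y [].
have hWU : W' `<=` U by move=> y /hWV/h.
exists W', hWV; split => //; apply: sub_finite_set fW => i /=.
apply: contraNN => /eqP e.
by rewrite (rs_res_comp h hWV hWU) -(rs_res_comp hW hWW hWU) e rmorph0.
Qed.
Definition fs_res (U V : opens X) (h : V `<=` U) (s : freeSec U) : freeSec V :=
  FreeSec (fs_res_subproof h s).

Lemma fs_resD (U V : opens X) (h : V `<=` U) : {morph fs_res h : s t / s + t}.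
Proof. by move=> s t; apply: freeSecP => i /=; rewrite rmorphD. Qed.
Lemma fs_resZ (U V : opens X) (h : V `<=` U) a s :
  fs_res h (a *: s) = rs_res h a *: fs_res h s.
Proof. by apply: freeSecP => i /=; rewrite rmorphM. Qed.
Lemma fs_res_id (U : opens X) (h : U `<=` U) s : fs_res h s = s.
Proof. by apply: freeSecP => i /=; rewrite rs_res_id. Qed.
Lemma fs_res_comp (U V W : opens X)
    (hVU : V `<=` U) (hWV : W `<=` V) (hWU : W `<=` U) s :
  fs_res hWV (fs_res hVU s) = fs_res hWU s.
Proof. by apply: freeSecP => i /=; rewrite (rs_res_comp hVU hWV hWU). Qed.

Lemma fs_sheaf : is_sheaf fs_res.
Proof.
move=> U J V VU cov s sP.
have ex i : exists t : rs_sec X U, forall j, rs_res (VU j) t = s j i.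
  have [|t [tP _]] := rs_sheaf VU cov (s := fun j => s j i); last by exists t.
  by move=> j j' W hj hj' /=; have /(congr1 (fun f : freeSec W => f i)) := sP j j' W hj hj'.
pose t i := projT1 (cid (ex i)).
have tP i j : rs_res (VU j) (t i) = s j i by rewrite /t; case: cid.
have tfin : locally_finite t.
  move=> x Ux; have [j Vx] := cov x Ux.
  have [W [hW [Wx fW]]] := fs_finite (s j) Vx.
  have hWU : W `<=` U by move=> y /hW/VU.
  exists W, hWU; split => //; apply: sub_finite_set fW => i /=.
  by rewrite -tP (rs_res_comp (VU j) hW hWU).
exists (FreeSec tfin); split => [j|u uP].
  by apply: freeSecP => i; exact: tP.
apply: freeSecP => i /=.
have [|w [_ wU]] := rs_sheaf VU cov (s := fun j => s j i).
  by move=> j j' W hj hj' /=; have /(congr1 (fun f : freeSec W => f i)) := sP j j' W hj hj'.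
rewrite -(wU (t i)); last exact: tP.
by apply: wU => j; rewrite -(uP j).
Qed.

Definition freeSheaf : modSheaf X :=
  ModSheaf fs_resD fs_resZ fs_res_id fs_res_comp fs_sheaf.
End FreeSheaf.

Definition quasi_coherent (X : ringedSpace) (M : modSheaf X) : Prop :=
  forall x : X, exists U : opens X, oset U x /\
    exists (I J : Type) (u : modHom_on U (freeSheaf X J) (freeSheaf X I))
      (v : modHom_on U (freeSheaf X I) M),
      exact_on u v /\ epi_on v.

Section Pushforward.
Variables (X Y : ringedSpace) (f : ringedMorphism X Y) (M : modSheaf X).
Local Notation pre := (opre (rm_continuous f)).

Lemma pre_sub (V W : opens Y) : W `<=` V -> pre W `<=` pre V.
Proof. by move=> h x /h. Qed.

Definition push_sec (V : opens Y) : lmodType (rs_sec Y V) :=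
  restrict_scalars (rm_sharp f V) (M (pre V)).
Definition push_res (V W : opens Y) (h : W `<=` V) (s : push_sec V) : push_sec W :=
  ms_res (pre_sub h) (s : M (pre V)).

Lemma push_resD (U V : opens Y) (h : V `<=` U) : {morph push_res h : s t / s + t}.
Proof. exact: ms_resD. Qed.
Lemma push_resZ (U V : opens Y) (h : V `<=` U) (a : rs_sec Y U) (s : push_sec U) :
  push_res h (a *: s) = rs_res h a *: push_res h s.
Proof. by rewrite [LHS]ms_resZ (rm_natural h). Qed.
Lemma push_res_id (U : opens Y) (h : U `<=` U) s : push_res h s = s.
Proof. exact: ms_res_id. Qed.
Lemma push_res_comp (U V W : opens Y)
    (hVU : V `<=` U) (hWV : W `<=` V) (hWU : W `<=` U) s :
  push_res hWV (push_res hVU s) = push_res hWU s.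
Proof. exact: ms_res_comp. Qed.
Lemma push_sheaf : is_sheaf push_res.
Proof.
move=> U I V VU cov s sP.
apply: (ms_sheaf (fun i => pre_sub (VU i))) => [x Ux|i j W hi hj].
  exact: (cov (f x) Ux).
pose VIJ := Opens (openI (oset_open (V i)) (oset_open (V j))).
have hI : VIJ `<=` V i by move=> y [].
have hJ : VIJ `<=` V j by move=> y [].
have hW : W `<=` pre VIJ by move=> y Wy; split; [exact: hi|exact: hj].
rewrite -(ms_res_comp (pre_sub hI) hW hi) -(ms_res_comp (pre_sub hJ) hW hj).
by congr (ms_res hW _); exact: sP.
Qed.

Definition pushforward : modSheaf Y :=
  ModSheaf push_resD push_resZ push_res_id push_res_comp push_sheaf.
End Pushforward.

Section PushforwardHom.
Variables (X Y : ringedSpace) (f : ringedMorphism X Y) (M N : modSheaf X).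
Variable u : modHom M N.
Local Notation pre := (opre (rm_continuous f)).

Definition push_fun (V : opens Y) (s : pushforward f M V) : pushforward f N V :=
  u (pre V) (@subsetT _ _) (s : M (pre V)).

Lemma push_fun_linear V : linear (@push_fun V).
Proof. by move=> a s t; rewrite /push_fun; exact: linearP. Qed.
HB.instance Definition _ V :=
  GRing.isLinear.Build _ _ _ _ (@push_fun V) (@push_fun_linear V).

Lemma push_fun_natural (V W : opens Y) (hVU : V `<=` oT Y) (hWU : W `<=` oT Y)
    (hWV : W `<=` V) (s : pushforward f M V) :
  ms_res hWV (push_fun s) = push_fun (ms_res hWV s).
Proof.
exact: (mh_natural u (@subsetT _ (pre V)) (@subsetT _ (pre W)) (pre_sub (f := f) hWV) s).
Qed.

Definition pushforward_hom : modHom (pushforward f M) (pushforward f N) :=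
  @ModHom Y (oT Y) (pushforward f M) (pushforward f N)
    (fun V _ => (@push_fun V : {linear _ -> _})) push_fun_natural.
End PushforwardHom.

Definition injective_sheaf (X : ringedSpace) (N : modSheaf X) : Prop :=
  forall (A B : modSheaf X) (u : modHom A B) (v : modHom A N), monic_on u ->
  exists w : modHom B N, forall (V : opens X) (hV : V `<=` oT X) (s : A V), w V hV (u V hV s) = v V hV s.

Record injectiveResolution (X : ringedSpace) (M : modSheaf X) := InjRes {
  ir_term : nat -> modSheaf X;
  ir_d : forall n, modHom (ir_term n) (ir_term n.+1);
  ir_aug : modHom M (ir_term 0%N);
  ir_injective : forall n, injective_sheaf (ir_term n);
  ir_monic : monic_on ir_aug;
  ir_exact0 : exact_on ir_aug (ir_d 0%N);
  ir_exactS : forall n, exact_on (ir_d n) (ir_d n.+1) }.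

Definition is_kernel (X : ringedSpace) (B C : modSheaf X) (v : modHom B C)
    (H : modSheaf X) : Prop :=
  exists j : modHom H B, monic_on j /\ exact_on j v.

(* H is the cokernel of the morphism a from A to the kernel K of v through which
   u factors. *)
Definition is_cohomology (X : ringedSpace) (A B C : modSheaf X)
    (u : modHom A B) (v : modHom B C) (H : modSheaf X) : Prop :=
  exists (K : modSheaf X) (j : modHom K B) (a : modHom A K) (p : modHom K H),
    [/\ monic_on j, exact_on j v,
        (forall (V : opens X) (hV : V `<=` oT X) (s : A V), j V hV (a V hV s) = u V hV s),
        exact_on a p & epi_on p].

(* N is a value at M of the i-th right derived functor of f_*: the i-th cohomology
   sheaf of the complex f_* I, for an injective resolution I of M. Derived
   functors being defined up to isomorphism only, this is a relation. *)
Definition is_higher_direct_image (X Y : ringedSpace) (f : ringedMorphism X Y)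
    (i : nat) (M : modSheaf X) (N : modSheaf Y) : Prop :=
  exists I : injectiveResolution M,
    match i with
    | 0 => is_kernel (pushforward_hom f (ir_d I 0%N)) N
    | n.+1 => is_cohomology (pushforward_hom f (ir_d I n))
                            (pushforward_hom f (ir_d I n.+1)) N
    end.
Definition min_nbhs (X : topologicalType) (p : X) : set X :=
  \bigcap_(U in [set U : set X | open U /\ U p]) U.

Lemma min_nbhs_self (X : topologicalType) (p : X) : min_nbhs p p.
Proof. by move=> U []. Qed.

Lemma min_nbhs_sub (X : topologicalType) (p : X) (U : set X) :
  open U -> U p -> min_nbhs p `<=` U.
Proof. by move=> oU Up q; apply. Qed.

Lemma min_nbhs_open (X : topologicalType) (p : X) :
  finite_set [set: X] -> open (min_nbhs p).
Proof.
move=> fX; rewrite openE => q qp; change (nbhs q (min_nbhs p)).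
pose F (r : X) : set X := if pselect (exists2 U, nbhs q U & ~ U r) is left h
  then projT1 (cid2 h) else setT.
have FP r : nbhs q (F r).
  by rewrite /F; case: pselect => [h|_]; [case: cid2|exact: filterT].
have [D DP] := finite_fsetP.1 fX.
have FI : nbhs q (\bigcap_(r in [set` D]) F r).
  by apply: filter_bigI => r _; exact: FP.
apply: filterS FI => r hr U [oU Up]; apply: contrapT => nUr.
have : F r r by apply: hr; rewrite -DP.
rewrite /F; case: pselect => [h|[]]; first by case: cid2.
by exists U => //; apply: open_nbhs_nbhs; split => //; apply: qp.
Qed.

Definition spec_le (X : topologicalType) (p q : X) : Prop := min_nbhs p q.

Lemma spec_leP (X : topologicalType) (p q : X) :
  spec_le p q -> min_nbhs q `<=` min_nbhs p.
Proof. by move=> pq r qr U [oU Up]; apply: qr; split => //; exact: pq. Qed.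

(* rfs_base is the morphism to the one-point ringed space of k. No separation
   axiom is imposed, so that spec_le is only a preorder. *)
Record ringedFiniteSpace (k : comPzRingType) := RingedFiniteSpace {
  rfs_space :> ringedSpace;
  rfs_finite : finite_set [set: rfs_space];
  rfs_base : {rmorphism k -> rs_sec rfs_space (oT rfs_space)} }.

Section RingedFiniteSpace.
Variables (k : comPzRingType) (X : ringedFiniteSpace k).

Definition Umin (p : X) : opens X := Opens (min_nbhs_open p (rfs_finite X)).

Definition stalk (p : X) : comPzRingType := rs_sec X (Umin p).

Definition stalk_map (p q : X) (pq : spec_le p q) : {rmorphism stalk p -> stalk q} :=
  rs_res (spec_leP pq : Umin q `<=` Umin p).

Definition stalk_base (p : X) : {rmorphism k -> stalk p} :=
  rs_res (@subsetT _ (Umin p) : Umin p `<=` oT X) \o rfs_base X.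

Lemma stalk_map_base (p q : X) (pq : spec_le p q) c :
  stalk_map pq (stalk_base p c) = stalk_base q c.
Proof. exact: rs_res_comp. Qed.

Definition finite_space : Prop :=
  forall (p q : X) (pq : spec_le p q), flat (stalk_map pq).

Definition germ (U : opens X) (p : X) (Up : oset U p) : {rmorphism rs_sec X U -> stalk p} :=
  rs_res (min_nbhs_sub (oset_open U) Up : Umin p `<=` U).

Lemma stalk_map_germ (U : opens X) (p q : X) (Up : oset U p) (Uq : oset U q)
    (pq : spec_le p q) s :
  stalk_map pq (germ Up s) = germ Uq s.
Proof. exact: rs_res_comp. Qed.
End RingedFiniteSpace.

Record stalkData (Z : topologicalType) := StalkData {
  sd_ring :> Z -> comPzRingType;
  sd_map : forall p q, spec_le p q -> {rmorphism sd_ring p -> sd_ring q};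
  sd_map_id : forall p (h : spec_le p p) s, sd_map h s = s;
  sd_map_comp : forall p q r (hpq : spec_le p q) (hqr : spec_le q r)
    (hpr : spec_le p r) s, sd_map hqr (sd_map hpq s) = sd_map hpr s }.

Section StalkSheaf.
Variables (Z : topologicalType) (A : stalkData Z).

(* The sections over U of the sheaf with stalks A p: elements of the limit of the
   A p over the points p of U; see stalk_spaceE. *)
Record stalkSec (U : opens Z) := StalkSec {
  ss_val :> forall p, oset U p -> A p;
  ss_compat : forall p q (Up : oset U p) (Uq : oset U q) (pq : spec_le p q),
    sd_map A pq (ss_val Up) = ss_val Uq }.

HB.instance Definition _ U := gen_eqMixin (stalkSec U).
HB.instance Definition _ U := gen_choiceMixin (stalkSec U).

Lemma stalkSecP U (s t : stalkSec U) :
  (forall p (Up : oset U p), s p Up = t p Up) -> s = t.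
Proof.
case: s t => s hs [t ht] /= st.
have {}st : s = t by apply/functional_extensionality_dep => p; apply/funext.
by case: _ / st ht => ht; congr StalkSec; exact: Prop_irrelevance.
Qed.

Section Ops.
Variable U : opens Z.
Implicit Types s t : stalkSec U.

Program Definition ss_zero := @StalkSec U (fun p _ => 0) _.
Next Obligation. by move=> p q Up Uq pq /=; rewrite rmorph0. Qed.
Program Definition ss_one := @StalkSec U (fun p _ => 1) _.
Next Obligation. by move=> p q Up Uq pq /=; rewrite rmorph1. Qed.
Program Definition ss_opp s := @StalkSec U (fun p Up => - s p Up) _.
Next Obligation.
by move=> s p q Up Uq pq /=; rewrite rmorphN (ss_compat s Up Uq).
Qed.
Program Definition ss_add s t := @StalkSec U (fun p Up => s p Up + t p Up) _.
Next Obligation.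
by move=> s t p q Up Uq pq /=; rewrite rmorphD (ss_compat s Up Uq) (ss_compat t Up Uq).
Qed.
Program Definition ss_mul s t := @StalkSec U (fun p Up => s p Up * t p Up) _.
Next Obligation.
by move=> s t p q Up Uq pq /=; rewrite rmorphM (ss_compat s Up Uq) (ss_compat t Up Uq).
Qed.

Lemma ss_addA : associative ss_add.
Proof. by move=> x y z; apply: stalkSecP => p Up /=; rewrite addrA. Qed.
Lemma ss_addC : commutative ss_add.
Proof. by move=> x y; apply: stalkSecP => p Up /=; rewrite addrC. Qed.
Lemma ss_add0 : left_id ss_zero ss_add.
Proof. by move=> x; apply: stalkSecP => p Up /=; rewrite add0r. Qed.
Lemma ss_addN : left_inverse ss_zero ss_opp ss_add.
Proof. by move=> x; apply: stalkSecP => p Up /=; rewrite addNr. Qed.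
HB.instance Definition _ := GRing.isZmodule.Build (stalkSec U)
  ss_addA ss_addC ss_add0 ss_addN.

Lemma ss_mulA : associative ss_mul.
Proof. by move=> x y z; apply: stalkSecP => p Up /=; rewrite mulrA. Qed.
Lemma ss_mulC : commutative ss_mul.
Proof. by move=> x y; apply: stalkSecP => p Up /=; rewrite mulrC. Qed.
Lemma ss_mul1 : left_id ss_one ss_mul.
Proof. by move=> x; apply: stalkSecP => p Up /=; rewrite mul1r. Qed.
Lemma ss_mulDl : left_distributive ss_mul +%R.
Proof. by move=> x y z; apply: stalkSecP => p Up /=; rewrite mulrDl. Qed.
HB.instance Definition _ := GRing.Zmodule_isComPzRing.Build (stalkSec U)
  ss_mulA ss_mulC ss_mul1 ss_mulDl.
End Ops.

Section Res.
Variables (U V : opens Z) (h : V `<=` U).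
Program Definition ss_res (s : stalkSec U) :=
  @StalkSec V (fun p Vp => s p (h Vp)) _.
Next Obligation. by move=> s p q Vp Vq pq /=; exact: ss_compat. Qed.

Lemma ss_res_is_zmod_morphism : zmod_morphism ss_res.
Proof. by move=> s t; apply: stalkSecP. Qed.
Lemma ss_res_is_monoid_morphism : monoid_morphism ss_res.
Proof. by split=> [|s t]; apply: stalkSecP. Qed.
HB.instance Definition _ := GRing.isZmodMorphism.Build _ _ ss_res
  ss_res_is_zmod_morphism.
HB.instance Definition _ := GRing.isMonoidMorphism.Build _ _ ss_res
  ss_res_is_monoid_morphism.
End Res.

Lemma ss_res_id (U : opens Z) (h : U `<=` U) s : ss_res h s = s.
Proof. by apply: stalkSecP => p Up /=; congr (ss_val s _); exact: Prop_irrelevance. Qed.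

Lemma ss_res_comp (U V W : opens Z)
    (hVU : V `<=` U) (hWV : W `<=` V) (hWU : W `<=` U) s :
  ss_res hWV (ss_res hVU s) = ss_res hWU s.
Proof. by apply: stalkSecP => p Wp /=; congr (ss_val s _); exact: Prop_irrelevance. Qed.

Lemma ss_sheaf : is_sheaf ss_res.
Proof.
move=> U I V VU cov s sP.
have sE i j p (hi : oset (V i) p) (hj : oset (V j) p) : s i p hi = s j p hj.
  pose W := Opens (openI (oset_open (V i)) (oset_open (V j))).
  have Wi : W `<=` V i by move=> y [].
  have Wj : W `<=` V j by move=> y [].
  have := congr1 (fun t : stalkSec W => t p (conj hi hj)) (sP i j W Wi Wj).
  rewrite /= => e; rewrite (Prop_irrelevance hi (Wi p (conj hi hj))) e.
  by congr (ss_val _ _); exact: Prop_irrelevance.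
pose t p (Up : oset U p) : A p := s _ p (projT2 (cid (cov p Up))).
have tE p (Up : oset U p) i (Vp : oset (V i) p) : t p Up = s i p Vp by exact: sE.
have tc p q (Up : oset U p) (Uq : oset U q) (pq : spec_le p q) :
    sd_map A pq (t p Up) = t q Uq.
  have [i Vp] := cov p Up.
  have Vq : oset (V i) q by apply: pq; split => //; exact: oset_open.
  by rewrite (tE p Up i Vp) (tE q Uq i Vq) (ss_compat (s i) Vp Vq pq).
exists (StalkSec tc); split => [i|u uP].
  by apply: stalkSecP => p Vp /=; exact: sE.
apply: stalkSecP => p Up /=; have [i Vp] := cov p Up.
rewrite (tE p Up i Vp) -(uP i) /=; congr (ss_val u _); exact: Prop_irrelevance.
Qed.

Lemma stalk_spaceE (p : Z) (U : opens Z) (Up : oset U p) :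
  oset U `<=` min_nbhs p -> bijective (fun s : stalkSec U => s p Up).
Proof.
move=> Us.
have gc (a : A p) q r (Uq : oset U q) (Ur : oset U r) (qr : spec_le q r) :
    sd_map A qr (sd_map A (Us q Uq) a) = sd_map A (Us r Ur) a.
  exact: sd_map_comp.
exists (fun a => StalkSec (gc a)) => [s|a] /=; last exact: sd_map_id.
by apply: stalkSecP => q Uq /=; exact: ss_compat.
Qed.

Definition stalk_space : ringedSpace :=
  @RingedSpace Z (fun U => stalkSec U : comPzRingType)
    (fun U V h => ss_res h : {rmorphism stalkSec U -> stalkSec V})
    ss_res_id ss_res_comp ss_sheaf.
End StalkSheaf.

Lemma spec_le_image (X Y : topologicalType) (f : X -> Y) (p q : X) :
  continuous f -> spec_le p q -> spec_le (f p) (f q).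
Proof.
move=> cf pq U [oU Up]; apply: (pq (f @^-1` U)); split => //.
by apply: open_comp => // x _; exact: cf.
Qed.

Section Product.
Variables (k : comPzRingType) (X Y : ringedFiniteSpace k).
Local Notation Z := (X * Y)%type.

Definition prod_stalk (z : Z) : comPzRingType :=
  tensalg (stalk_base z.1) (stalk_base z.2).

Lemma spec_le1 (z w : Z) : spec_le z w -> spec_le z.1 w.1.
Proof. by apply: spec_le_image => x; exact: cvg_fst. Qed.
Lemma spec_le2 (z w : Z) : spec_le z w -> spec_le z.2 w.2.
Proof. by apply: spec_le_image => x; exact: cvg_snd. Qed.

Definition prod_stalk_map (z w : Z) (zw : spec_le z w) :
    {rmorphism prod_stalk z -> prod_stalk w} :=
  tensalg_map (stalk_map_base (spec_le1 zw)) (stalk_map_base (spec_le2 zw)).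

Lemma prod_stalk_map_id (z : Z) (h : spec_le z z) s : prod_stalk_map h s = s.
Proof.
by apply: tensalg_map_id => x; exact: rs_res_id.
Qed.

Lemma prod_stalk_map_comp (p q r : Z) (hpq : spec_le p q) (hqr : spec_le q r)
    (hpr : spec_le p r) s :
  prod_stalk_map hqr (prod_stalk_map hpq s) = prod_stalk_map hpr s.
Proof.
by apply: tensalg_map_comp => x; exact: rs_res_comp.
Qed.

Definition prod_data : stalkData Z :=
  StalkData prod_stalk_map_id prod_stalk_map_comp.

Lemma fst_continuous : continuous (@fst X Y).
Proof. by move=> z; exact: cvg_fst. Qed.

Section ProjSharp.
Variable V : opens X.
Local Notation pV := (opre fst_continuous V).

Lemma proj_sharp_subproof (s : rs_sec X V) (z w : Z)
    (Vz : oset pV z) (Vw : oset pV w) (zw : spec_le z w) :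
  sd_map prod_data zw (ta_inl (stalk_base z.1) (stalk_base z.2) (germ (Vz : oset V z.1) s))
  = ta_inl (stalk_base w.1) (stalk_base w.2) (germ (Vw : oset V w.1) s).
Proof.
rewrite [LHS]tensalg_map_pure rmorph1; congr (purea _ _ _ _).
exact: stalk_map_germ.
Qed.

Definition proj_sharp (s : rs_sec X V) : stalkSec prod_data pV :=
  StalkSec (proj_sharp_subproof s).

Lemma proj_sharp_is_zmod_morphism : zmod_morphism proj_sharp.
Proof. by move=> s t; apply: stalkSecP => z Vz /=; rewrite !rmorphB. Qed.
Lemma proj_sharp_is_monoid_morphism : monoid_morphism proj_sharp.
Proof.
split=> [|s t]; apply: stalkSecP => z Vz /=; first by rewrite !rmorph1.
by rewrite !rmorphM.
Qed.
HB.instance Definition _ := GRing.isZmodMorphism.Build _ _ proj_sharp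
  proj_sharp_is_zmod_morphism.
HB.instance Definition _ := GRing.isMonoidMorphism.Build _ _ proj_sharp
  proj_sharp_is_monoid_morphism.
End ProjSharp.
Arguments proj_sharp : clear implicits.

Lemma prod_finite : finite_set [set: Z].
Proof. by rewrite -setXTT; apply: finite_setX; exact: rfs_finite. Qed.

Definition prod_base : {rmorphism k -> rs_sec (stalk_space prod_data) (oT Z)} :=
  ss_res (A := prod_data) (@subset_refl _ setT : oT Z `<=` opre fst_continuous (oT X))
  \o proj_sharp (oT X) \o rfs_base X.

Definition prod_space : ringedFiniteSpace k :=
  @RingedFiniteSpace k (stalk_space prod_data) prod_finite prod_base.

Lemma proj_natural (V W : opens X) (h : W `<=` V)
    (h' : opre fst_continuous W `<=` opre fst_continuous V) s :
  ss_res h' (proj_sharp V s) = proj_sharp W (rs_res h s).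
Proof.
apply: stalkSecP => z Wz /=; congr (ta_inl _ _ _).
by apply/esym; exact: rs_res_comp.
Qed.

Definition prod_proj : ringedMorphism prod_space X :=
  @RingedMorphism prod_space X fst fst_continuous
    (fun V => proj_sharp V : {rmorphism _ -> _}) proj_natural.
End Product.

(* Main.v *)
Require Import Defs.
From HB Require Import structures.
From mathcomp Require Import all_boot all_order all_algebra.
From mathcomp Require Import all_classical.
From mathcomp Require Import finmap topology.
Set Implicit Arguments.
Unset Strict Implicit.
Unset Printing Implicit Defensive.
Import GRing.Theory.
Local Open Scope classical_set_scope.
Local Open Scope ring_scope.
Local Open Scope quotient_scope.

(* For p <= q in X, flatness of O_p -> O_q reduces the theorem to the following
   assertion, I being an injective resolution of M: the complex of sections of I
   over U_p x X', tensored with O_q over O_p, is quasi-isomorphic to the complex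
   of sections over U_q x X'. It is proved with X' replaced by an arbitrary open
   subset W, by induction on the number of points of W. If W is the smallest
   neighbourhood of a point x', both complexes are resolutions, of
   M_(p,x') (x) O_q and of M_(q,x'), and these modules agree because M is
   quasi-coherent. Otherwise W is exhausted by adding its minimal neighbourhoods
   U_x one at a time, and Mayer-Vietoris applies since injective sheaves are
   flasque. Finally, a sheaf N on X such that N_p (x) O_q = N_q for all p <= q has
   a presentation over each U_p, whose generators are all the elements of N_p. *)

(** * Base change of modules *)

(** The terms of an injective resolution are in general not quasi-coherent, so base change cannot be
    checked term by term: it holds for the whole complex of sections, and only up to
    quasi-isomorphism. The comparison is therefore phrased as acyclicity of a mapping cone.
    Mayer-Vietoris then says that a complex is acyclic once the three others in a degreewise exact
    square of cones are, and neither cohomology groups nor the five lemma appear. Over the product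
    of U_p and U_x' the key identity is O_q (x)_{O_p} (O_p (x)_k O_x') = O_q (x)_k O_x': tensoring a
    stalk of M with O_q over O_p is the same as base change between stalks of the structure sheaf of
    the product, and the latter is governed by a presentation of M. Flatness of O_p -> O_q enters
    three times: the tensored resolution over a minimal neighbourhood stays exact, the tensored
    Mayer-Vietoris sequences stay exact on the left, and kernels and cohomology commute with the
    tensor product at the end. The induction runs over all open W because U_x need not meet the
    union already built in a minimal neighbourhood. *)

Definition additive_of (U V : zmodType) (h : U -> V)
    (hD : {morph h : x y / x + y}) : {additive U -> V} :=
  HB.pack h (GRing.isZmodMorphism.Build U V h (zmod_morphismD hD)).

Definition linear_of (R : pzRingType) (U V : lmodType R) (h : U -> V)
    (hl : linear h) : {linear U -> V} :=
  HB.pack h (GRing.isLinear.Build R U V *:%R h hl).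

Section QuotientModule.
Variables (R : pzRingType) (B : lmodType R) (D : B -> Prop).
Hypotheses (D0 : D 0) (DD : forall a x y, D x -> D y -> D (a *: x + y)).

Definition quo_rel (x y : B) : bool := `[< D (x - y) >].

Lemma quo_rel_refl : reflexive quo_rel.
Proof. by move=> x; apply/asboolP; rewrite subrr. Qed.
Lemma quo_rel_sym : symmetric quo_rel.
Proof.
by move=> x y; apply/asboolP/asboolP => /(DD (-1))/(_ D0); rewrite addr0 scaleN1r opprB.
Qed.
Lemma quo_rel_trans : transitive quo_rel.
Proof.
move=> y x z /asboolP xy /asboolP yz; apply/asboolP.
by move: (DD 1 xy yz); rewrite scale1r addrA subrK.
Qed.

Definition quo_equiv := EquivRel quo_rel quo_rel_refl quo_rel_sym quo_rel_trans.
Definition quo := {eq_quot quo_equiv}.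
HB.instance Definition _ := Choice.on quo.
HB.instance Definition _ := EqQuotient.on quo.

Local Notation cl x := (\pi_quo x).

Lemma quo_eqP (x y : B) : cl x = cl y <-> D (x - y).
Proof. by split=> [/eqquotP/asboolP|h]; last apply/eqquotP/asboolP. Qed.

Lemma quo_repr (x : B) : D (repr (cl x) - x).
Proof. by apply/quo_eqP; exact: reprK. Qed.

Definition quo_add (x y : quo) : quo := cl (repr x + repr y).
Definition quo_scale (a : R) (x : quo) : quo := cl (a *: repr x).

Lemma quo_addE x y : quo_add (cl x) (cl y) = cl (x + y).
Proof.
apply/quo_eqP; have := DD 1 (quo_repr x) (quo_repr y).
by rewrite scale1r opprD addrACA.
Qed.
Lemma quo_scaleE a x : quo_scale a (cl x) = cl (a *: x).
Proof.
by apply/quo_eqP; have := DD a (quo_repr x) D0; rewrite addr0 scalerBr.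
Qed.

Lemma quoP (P : quo -> Prop) : (forall x, P (cl x)) -> forall x, P x.
Proof. by move=> h x; rewrite -[x]reprK. Qed.

Lemma quo_addA : associative quo_add.
Proof.
by elim/quoP=> x; elim/quoP=> y; elim/quoP=> z; rewrite !quo_addE addrA.
Qed.
Lemma quo_addC : commutative quo_add.
Proof. by elim/quoP=> x; elim/quoP=> y; rewrite !quo_addE addrC. Qed.
Lemma quo_add0 : left_id (cl 0) quo_add.
Proof. by elim/quoP=> x; rewrite quo_addE add0r. Qed.
Lemma quo_addN : left_inverse (cl 0) (quo_scale (-1)) quo_add.
Proof. by elim/quoP=> x; rewrite quo_scaleE quo_addE scaleN1r addNr. Qed.
HB.instance Definition _ := GRing.isZmodule.Build quo
  quo_addA quo_addC quo_add0 quo_addN.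

Lemma quo_scaleA a c t : quo_scale a (quo_scale c t) = quo_scale (a * c) t.
Proof. by elim/quoP: t => x; rewrite !quo_scaleE scalerA. Qed.
Lemma quo_scale1 : left_id 1 quo_scale.
Proof. by elim/quoP=> x; rewrite quo_scaleE scale1r. Qed.
Lemma quo_scaleDr : right_distributive quo_scale +%R.
Proof.
move=> a; elim/quoP=> x; elim/quoP=> y.
by rewrite [_ + _]quo_addE !quo_scaleE [RHS]quo_addE scalerDr.
Qed.
Lemma quo_scaleDl t : {morph quo_scale^~ t : a b / a + b}.
Proof.
by elim/quoP: t => x a b; rewrite !quo_scaleE [RHS]quo_addE scalerDl.
Qed.
HB.instance Definition _ := GRing.Zmodule_isLmodule.Build R quo
  quo_scaleA quo_scale1 quo_scaleDr quo_scaleDl.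

(** Used to prove that an element lies in a submodule [D], typically the image of a map: its class
    in the quotient is shown to vanish, which can be done with maps out of a tensor product. Only
    the projection and its kernel matter, hence the existential form. *)
Lemma quotient_module :
  exists (Q : lmodType R) (pi : {linear B -> Q}),
    (forall q, exists b, pi b = q) /\ forall b, pi b = 0 <-> D b.
Proof.
have lin : linear (fun x : B => cl x : quo).
  by move=> a x y; rewrite -quo_addE -quo_scaleE.
exists quo, (linear_of lin); split => [q|b] /=.
  by exists (repr q); exact: reprK.
by rewrite -[b in D b]subr0; exact: quo_eqP.
Qed.
End QuotientModule.

Section BaseChange.
Variables (R S : comPzRingType) (f : {rmorphism R -> S}).
Local Notation SR := (restrict_scalars f S^o).

Definition bc (N : lmodType R) : lmodType R := tens SR N.

Definition bcpure (N : lmodType R) (s : S) (n : N) : bc N := @pure R SR N s n.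

Lemma bcpure_bil (N : lmodType R) : is_bilinear (@bcpure N : SR -> N -> bc N).
Proof. exact: pure_bilinear. Qed.

Lemma bcpureDl (N : lmodType R) s t (n : N) : bcpure (s + t) n = bcpure s n + bcpure t n.
Proof. by case: (bcpure_bil N) => + _ _ _; exact. Qed.
Lemma bcpureDr (N : lmodType R) s (m n : N) : bcpure s (m + n) = bcpure s m + bcpure s n.
Proof. by case: (bcpure_bil N) => _ + _ _; exact. Qed.
Lemma bcpureZ (N : lmodType R) s a (n : N) : bcpure s (a *: n) = bcpure (s * f a) n.
Proof. by case: (bcpure_bil N) => _ _ h3 h4; rewrite h4 -h3 mulrC. Qed.
Lemma bcpure0 (N : lmodType R) s : bcpure s (0 : N) = 0.
Proof. by apply: (addIr (bcpure s (0 : N))); rewrite -bcpureDr !add0r. Qed.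

Lemma bc_sum (N : lmodType R) (t : bc N) :
  exists l : seq (S * N), t = \sum_(p <- l) bcpure p.1 p.2.
Proof. by exists (repr t); exact: (tens_sum_pure t). Qed.

(** Additive maps are compared because the source is an R-module while the target is often an
    S-module. *)
Lemma bc_ext (N : lmodType R) (V : zmodType) (h h' : {additive bc N -> V}) :
  (forall s n, h (bcpure s n) = h' (bcpure s n)) -> h =1 h'.
Proof.
by move=> e t; have [l ->] := bc_sum t; rewrite !raddf_sum; apply: eq_bigr.
Qed.

Lemma bc_lift (N P : lmodType R) (b : SR -> N -> P) : is_bilinear b ->
  exists u : {linear bc N -> P}, forall s n, u (bcpure s n) = b s n.
Proof.
move=> hb; exists (linear_of (tens_lift_linear hb)) => s n /=.
exact: tens_lift_pure.
Qed.

Section Map.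
Variables (N N' : lmodType R) (u : {linear N -> N'}).
Let bil : is_bilinear (fun (m : SR) (n : N) => pure m (u n)).
Proof. by apply: tens_map_bilinear => // a x y; rewrite linearP. Qed.
Let bcm_subproof : { v : {linear bc N -> bc N'} |
  v =1 tens_map (M := SR) idfun u /\ forall s n, v (bcpure s n) = bcpure s (u n) }.
Proof.
by exists (linear_of (tens_lift_linear bil)); split => // s n; exact: tens_lift_pure.
Qed.
Definition bcm : {linear bc N -> bc N'} := sval bcm_subproof.
Lemma bcm_tens_map : bcm =1 tens_map (M := SR) idfun u.
Proof. by case: (svalP bcm_subproof). Qed.
Lemma bcmE s n : bcm (bcpure s n) = bcpure s (u n).
Proof. by case: (svalP bcm_subproof) => _; exact. Qed.
End Map.

Lemma bcm_comp (N N' N'' : lmodType R) (u : {linear N -> N'}) (v : {linear N' -> N''})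
    (w : {linear N -> N''}) : (forall n, v (u n) = w n) ->
  forall t, bcm v (bcm u t) = bcm w t.
Proof.
move=> e; apply: (bc_ext (h := bcm v \o bcm u) (h' := bcm w)) => s n /=.
by rewrite !bcmE e.
Qed.

Lemma bcm0 (N N' : lmodType R) (u : {linear N -> N'}) : (forall n, u n = 0) ->
  forall t, bcm u t = 0.
Proof.
move=> e; apply: (bc_ext (h := bcm u) (h' := \0)) => s n /=.
by rewrite bcmE e bcpure0.
Qed.

Lemma bcm_surj (N N' : lmodType R) (u : {linear N -> N'}) :
  (forall n, exists m, u m = n) ->
  forall t, exists t', bcm u t' = t.
Proof.
move=> us t; have [l ->] := bc_sum t.
elim: l => [|[s n] l [t' t'E]]; first by exists 0; rewrite big_nil raddf0.
have [m <-] := us n; exists (bcpure s m + t').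
by rewrite big_cons raddfD /= bcmE t'E.
Qed.

(** The projection [pi] onto the cokernel of [bcm u] factors through [bcm v]: send s (x) c to the
    class of s (x) b for any b above c. *)
Lemma bcm_right_exact (A B C : lmodType R) (u : {linear A -> B}) (v : {linear B -> C}) :
  (forall c, exists b, v b = c) -> (forall b, v b = 0 -> exists a, u a = b) ->
  forall t, bcm v t = 0 -> exists s, bcm u s = t.
Proof.
move=> vs ex t vt.
have [||Q [pi [_ piP]]] := @quotient_module R (bc B) (fun t => exists s, bcm u s = t).
- by exists 0; rewrite raddf0.
- by move=> a _ _ [x <-] [y <-]; exists (a *: x + y); rewrite linearP.
apply/piP.
(* A set-theoretic section of [v]. It need not be linear, since two elements above the same c differ
   by the image of [u], which [pi] kills. *)
pose g c := projT1 (cid (vs c)).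
have gK c : v (g c) = c by rewrite /g; case: cid.
have pig s b b' : v b = v b' -> pi (bcpure s b) = pi (bcpure s b').
  move=> e; apply/eqP; rewrite -subr_eq0 -raddfB; apply/eqP/piP.
  have [|a aE] := ex (b - b'); first by rewrite linearB e subrr.
  exists (bcpure s a); rewrite bcmE aE bcpureDr; congr (_ + _).
  by apply/eqP; rewrite -addr_eq0 -bcpureDr addNr bcpure0.
have bil : is_bilinear (fun (s : SR) (c : C) => pi (bcpure s (g c))).
  split => [s s' c|s c c'|a s c|a s c].
  - by rewrite bcpureDl raddfD.
  - by rewrite -raddfD -bcpureDr; apply: pig; rewrite linearD !gK.
  - by rewrite -linearZ; case: (bcpure_bil B) => _ _ -> _.
  - rewrite -linearZ; case: (bcpure_bil B) => _ _ _ <-.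
    by apply: pig; rewrite linearZ /= !gK.
have [w wE] := bc_lift bil.
have -> : pi t = w (bcm v t).
  move: t {vt}; apply: (bc_ext (h := pi) (h' := w \o bcm v)) => s b /=.
  by rewrite bcmE wE; apply: pig; rewrite gK.
by rewrite vt raddf0.
Qed.

Section Eval.
Variables (N : lmodType R) (L : lmodType S) (rho : {linear N -> restrict_scalars f L}).
Let bce_subproof : { e : {additive bc N -> L} |
  forall s n, e (bcpure s n) = s *: (rho n : L) }.
Proof.
have bil : is_bilinear (fun (s : SR) (n : N) =>
    ((s : S) *: (rho n : L)) : restrict_scalars f L).
  split=> [s t n|s m n|a s n|a s n].
  - exact: (@scalerDl S L (rho n) s t).
  - by rewrite linearD; exact: (@scalerDr S L s (rho m) (rho n)).
  - exact: (esym (@scalerA S L (f a) s (rho n))).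
  - rewrite linearZ; apply: (etrans (@scalerA S L s (f a) (rho n))); rewrite mulrC.
    exact: (esym (@scalerA S L (f a) s (rho n))).
apply: cid; have [w wE] := bc_lift bil.
have wD : {morph (w : bc N -> L) : x y / x + y} by move=> x y; exact: (raddfD w).
by exists (additive_of wD) => s n; exact: wE.
Qed.
(** The adjoint of [rho] under extension of scalars. It is recorded as additive only, because [bc N]
    is given just its R-module structure whereas [L] is an S-module. *)
Definition bce : {additive bc N -> L} := sval bce_subproof.
Lemma bceE s n : bce (bcpure s n) = s *: (rho n : L).
Proof. exact: (svalP bce_subproof). Qed.
End Eval.

Section Flat.
Hypothesis flatf : flat f.

Lemma bcm_inj (N N' : lmodType R) (u : {linear N -> N'}) :
  (forall n, u n = 0 -> n = 0) -> forall t, bcm u t = 0 -> t = 0.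
Proof.
move=> u0; have ui : injective u.
  move=> x y /eqP; rewrite -subr_eq0 -raddfB => /eqP/u0/eqP.
  by rewrite subr_eq0 => /eqP.
have inj : injective (bcm u) by apply: (eq_inj (flatf ui)) => t; rewrite bcm_tens_map.
by move=> t ut; apply: inj; rewrite ut raddf0.
Qed.

(** The hypothesis [flat] speaks of injections only, so [v] is factored through B modulo its kernel:
    right exactness treats the projection, flatness the induced injection into C. *)
Lemma bcm_exact (A B C : lmodType R) (u : {linear A -> B}) (v : {linear B -> C}) :
  (forall b, v b = 0 -> exists a, u a = b) ->
  forall t, bcm v t = 0 -> exists s, bcm u s = t.
Proof.
move=> ex t vt.
have [||Q [pi [pis piP]]] := @quotient_module R B (fun b => v b = 0).
- by rewrite raddf0.
- by move=> a x y xz yz; rewrite linearP /= xz yz scaler0 addr0.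
pose g c := projT1 (cid (pis c)).
have gK c : pi (g c) = c by rewrite /g; case: cid.
have vg b b' : pi b = pi b' -> v b = v b'.
  move=> e; apply/eqP; rewrite -subr_eq0 -raddfB; apply/eqP/piP.
  by rewrite linearB e subrr.
have lin : linear (fun q => v (g q)).
  by move=> a x y; rewrite -linearP; apply: vg; rewrite linearP !gK.
apply: (bcm_right_exact (v := pi)) => // [b /piP|]; first exact: ex.
apply: (bcm_inj (u := linear_of lin)) => [q /= /piP|].
  by rewrite gK.
rewrite -vt; apply: (bcm_comp (u := pi) (v := linear_of lin)) => b /=.
by apply: vg; rewrite gK.
Qed.

Variables (A A1 A2 A12 : lmodType R).
Variables (r1 : {linear A -> A1}) (r2 : {linear A -> A2}).
Variables (s1 : {linear A1 -> A12}) (s2 : {linear A2 -> A12}).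
Hypothesis inj : forall x, r1 x = 0 -> r2 x = 0 -> x = 0.
Hypothesis glue : forall x1 x2, s1 x1 = s2 x2 -> exists x, r1 x = x1 /\ r2 x = x2.

Let in1_lin : linear (fun x : A1 => (x, 0) : A1 * A2)%type.
Proof. by move=> a x y; apply: injective_projections; rewrite //= scaler0 addr0. Qed.
Let in2_lin : linear (fun x : A2 => (0, x) : A1 * A2)%type.
Proof. by move=> a x y; apply: injective_projections; rewrite //= scaler0 addr0. Qed.
Let in1 := linear_of in1_lin.
Let in2 := linear_of in2_lin.
Let pr1_lin : linear (fun x : A1 * A2 => x.1)%type.
Proof. by []. Qed.
Let pr2_lin : linear (fun x : A1 * A2 => x.2)%type.
Proof. by []. Qed.
Let pr1 := linear_of pr1_lin.
Let pr2 := linear_of pr2_lin.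
Let r_lin : linear (fun x => (r1 x, r2 x) : A1 * A2)%type.
Proof. by move=> a x y; rewrite !linearP. Qed.
Let r := linear_of r_lin.
Let s_lin : linear (fun x : A1 * A2 => s1 x.1 - s2 x.2)%type.
Proof.
move=> a x y; rewrite -[(_ + y).1]/(a *: x.1 + y.1) -[(_ + y).2]/(a *: x.2 + y.2).
rewrite (linearP s1) (linearP s2) /=. by rewrite scalerBr opprD addrACA.
Qed.
Let s := linear_of s_lin.

(** This identity takes the place of an isomorphism between the base change of A1 x A2 and the
    product of the base changes. *)
Let pr_in t : bcm in1 (bcm pr1 t) + bcm in2 (bcm pr2 t) = t.
Proof.
move: t; apply: (bc_ext (h := (bcm in1 \o bcm pr1) \+ (bcm in2 \o bcm pr2))
  (h' := idfun)) => c x /=.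
rewrite !bcmE -bcpureDr /=; congr bcpure.
by apply: injective_projections; rewrite /= ?addr0 ?add0r.
Qed.

Lemma bcm_joint_inj t : bcm r1 t = 0 -> bcm r2 t = 0 -> t = 0.
Proof.
move=> t1 t2; apply: (bcm_inj (u := r)) => [x [] /inj|]; first exact.
rewrite -[LHS]pr_in (bcm_comp (w := r1)) // (bcm_comp (w := r2)) //.
by rewrite t1 t2 !raddf0 addr0.
Qed.

(** The gluing condition is exactness at A1 x A2 of A -> A1 x A2 -> A12, where the second map is the
    difference of [s1] and [s2]; flatness preserves it. *)
Lemma bcm_glue t1 t2 : bcm s1 t1 = bcm s2 t2 ->
  exists t, bcm r1 t = t1 /\ bcm r2 t = t2.
Proof.
move=> e.
have sE1 : forall t, bcm s (bcm in1 t) = bcm s1 t.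
  by apply: bcm_comp => x /=; rewrite raddf0 subr0.
have sE2 t : bcm s (bcm in2 t) = - bcm s2 t.
  move: t; apply: (bc_ext (h := bcm s \o bcm in2) (h' := -%R \o bcm s2)) => c x /=.
  rewrite !bcmE /= raddf0 sub0r; apply/eqP.
  by rewrite -addr_eq0 -bcpureDr addNr bcpure0.
have [||t tE] := @bcm_exact _ _ _ r s _ (bcm in1 t1 + bcm in2 t2).
- move=> [x1 x2] /= /eqP; rewrite subr_eq0 => /eqP/glue[x [<- <-]].
  by exists x.
- by rewrite raddfD /= sE1 sE2 e subrr.
have p11 : forall t, bcm pr1 (bcm in1 t) = t.
  by apply: (bc_ext (h := bcm pr1 \o bcm in1) (h' := idfun)) => c x /=; rewrite !bcmE.
have p22 : forall t, bcm pr2 (bcm in2 t) = t.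
  by apply: (bc_ext (h := bcm pr2 \o bcm in2) (h' := idfun)) => c x /=; rewrite !bcmE.
have p12 : forall t, bcm pr1 (bcm in2 t) = 0.
  by apply: (bc_ext (h := bcm pr1 \o bcm in2) (h' := \0)) => c x /=;
    rewrite !bcmE bcpure0.
have p21 : forall t, bcm pr2 (bcm in1 t) = 0.
  by apply: (bc_ext (h := bcm pr2 \o bcm in1) (h' := \0)) => c x /=;
    rewrite !bcmE bcpure0.
exists t; split.
- by rewrite -(bcm_comp (u := r) (v := pr1)) // tE raddfD /= p11 p12 addr0.
- by rewrite -(bcm_comp (u := r) (v := pr2)) // tE raddfD /= p22 p21 add0r.
Qed.
End Flat.
End BaseChange.

(** * Complexes of abelian groups *)

Record complex := Complex {
  cx_obj :> nat -> zmodType;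
  cx_d : forall n, {additive cx_obj n -> cx_obj n.+1};
  cx_dd : forall n x, cx_d n.+1 (cx_d n x) = 0 }.

Arguments cx_d {c} n.

Record chainMap (A B : complex) := ChainMap {
  cm_fun :> forall n, {additive A n -> B n};
  cm_d : forall n x, cm_fun n.+1 (cx_d n x) = cx_d n (cm_fun n x) }.

Definition acyclic (C : complex) : Prop :=
  (forall x : C 0%N, cx_d 0 x = 0 -> x = 0) /\
  (forall n (x : C n.+1), cx_d n.+1 x = 0 -> exists y, cx_d n y = x).

Section Cone.
Variables (A B : complex) (phi : chainMap A B).

(** The mapping cone, shifted so that its lowest term A_0 sits in degree 0, with the sign of the
    differential put on the B component. Its acyclicity expresses that [phi] is a
    quasi-isomorphism. *)
Definition cone_obj (n : nat) : zmodType :=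
  match n with 0 => A 0%N | m.+1 => (A m.+1 * B m)%type end.

Let cone_d0D :
  {morph (fun a : A 0%N => (cx_d 0 a, phi 0%N a)) : x y / x + y >-> x + y}.
Proof. by move=> x y; rewrite (raddfD (cx_d 0)) (raddfD (phi 0%N)). Qed.

Let cone_dSD (n : nat) : {morph (fun x : A n.+1 * B n =>
  (cx_d n.+1 x.1, phi n.+1 x.1 - cx_d n x.2)) : x y / x + y >-> x + y}.
Proof.
move=> x y; rewrite -[(x + y).1]/(x.1 + y.1) -[(x + y).2]/(x.2 + y.2).
by rewrite (raddfD (cx_d n.+1)) (raddfD (phi n.+1)) (raddfD (cx_d n)) opprD addrACA.
Qed.

Definition cone_d (n : nat) : {additive cone_obj n -> cone_obj n.+1} :=
  match n with
  | 0 => additive_of cone_d0D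
  | m.+1 => additive_of (@cone_dSD m)
  end.

Lemma cone_dd n x : cone_d n.+1 (cone_d n x) = 0.
Proof.
case: n x => [|n] x /=; rewrite cx_dd ?cm_d ?subrr //.
by rewrite raddfB /= cx_dd subr0 subrr.
Qed.

Definition cone : complex := Complex cone_dd.

(** The clauses are exactness in degrees 0, 1 and n+2. Degree 1 is separate because the cone has no
    B component in degree 0, so that no b' can correct the preimage. *)
Lemma cone_acyclicP : acyclic cone <-> [/\
  forall a : A 0%N, cx_d 0 a = 0 -> phi 0%N a = 0 -> a = 0,
  forall (a : A 1%N) (b : B 0%N), cx_d 1 a = 0 -> phi 1%N a = cx_d 0 b ->
    exists a', cx_d 0 a' = a /\ phi 0%N a' = b &
  forall n (a : A n.+2) (b : B n.+1), cx_d n.+2 a = 0 -> phi n.+2 a = cx_d n.+1 b ->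
    exists a' b', cx_d n.+1 a' = a /\ phi n.+1 a' - cx_d n b' = b].
Proof.
split=> [[h0 h]|[h0 h1 h2]].
  split=> [a da pa|a b da pa|n a b da pa].
  - by apply: h0; rewrite /= da pa.
  - by have [|a' [<- <-]] := h 0%N (a, b); [rewrite /= da pa subrr|exists a'].
  - have [|[a' b'] [<- <-]] := h n.+1 (a, b); first by rewrite /= da pa subrr.
    by exists a', b'.
split=> [x /= [dx px]|[|n] [a b] /= [da /eqP]]; first exact: h0.
  rewrite subr_eq0 => /eqP pa.
  by have [a' [<- <-]] := h1 a b da pa; exists a'.
rewrite subr_eq0 => /eqP pa.
by have [a' [b' [<- <-]]] := h2 n a b da pa; exists (a', b').
Qed.
End Cone.

Section ConeMap.
Variables (A B A' B' : complex) (phi : chainMap A B) (phi' : chainMap A' B').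
Variables (u : chainMap A A') (v : chainMap B B').
Hypothesis uv : forall n x, phi' n (u n x) = v n (phi n x).

Let cone_mapD (n : nat) :
  {morph (fun x : A n.+1 * B n => (u n.+1 x.1, v n x.2)) : x y / x + y >-> x + y}.
Proof.
move=> x y; rewrite -[(x + y).1]/(x.1 + y.1) -[(x + y).2]/(x.2 + y.2).
by rewrite (raddfD (u n.+1)) (raddfD (v n)).
Qed.

Definition cone_map_fun (n : nat) : {additive cone phi n -> cone phi' n} :=
  match n with
  | 0 => u 0%N
  | m.+1 => additive_of (@cone_mapD m)
  end.

Lemma cone_map_d n x : cone_map_fun n.+1 (cx_d n x) = cx_d n (cone_map_fun n x).
Proof. by case: n x => [|n] x /=; rewrite ?raddfB /= ?cm_d uv. Qed.

Definition cone_map : chainMap (cone phi) (cone phi') := ChainMap cone_map_d.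
End ConeMap.

(** Degreewise exactness of 0 -> A -> A1 x A2 -> A12 -> 0. Surjectivity is asked of [s1] alone:
    flasque sheaves provide it in this form, and it passes to base changes and cones. *)
Definition mv_square (A A1 A2 A12 : complex) (r1 : chainMap A A1) (r2 : chainMap A A2)
    (s1 : chainMap A1 A12) (s2 : chainMap A2 A12) : Prop :=
  [/\ forall n x, s1 n (r1 n x) = s2 n (r2 n x),
      forall n x, r1 n x = 0 -> r2 n x = 0 -> x = 0,
      forall n x1 x2, s1 n x1 = s2 n x2 -> exists x, r1 n x = x1 /\ r2 n x = x2 &
      forall n y, exists x, s1 n x = y].

Lemma mv_acyclic (A A1 A2 A12 : complex) (r1 : chainMap A A1) (r2 : chainMap A A2)
    (s1 : chainMap A1 A12) (s2 : chainMap A2 A12) :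
  mv_square r1 r2 s1 s2 -> acyclic A1 -> acyclic A2 -> acyclic A12 -> acyclic A.
Proof.
move=> [comm inj glue surj] [h10 h1] [h20 h2] [h120 h12]; split=> [x dx|n x dx].
  by apply: inj; [apply: h10|apply: h20]; rewrite -cm_d dx raddf0.
have [|y1 y1E] := h1 n (r1 n.+1 x); first by rewrite -cm_d dx raddf0.
have [|y2 y2E] := h2 n (r2 n.+1 x); first by rewrite -cm_d dx raddf0.
(* The two primitives need not agree over A12; [y1] must be changed by a cocycle until they do,
   after which they glue. *)
suff [y1' [y1'E e]] : exists y1', cx_d n y1' = r1 n.+1 x /\ s1 n y1' = s2 n y2.
  have [y [yE1 yE2]] := glue n _ _ e; exists y; apply/eqP.
  rewrite -subr_eq0; apply/eqP; apply: inj; rewrite raddfB /= cm_d.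
    by rewrite yE1 y1'E subrr.
  by rewrite yE2 y2E subrr.
have dz : cx_d n (s1 n y1 - s2 n y2) = 0.
  by rewrite raddfB /= -!cm_d y1E y2E comm subrr.
(* In degree 0 the discrepancy is a cocycle of degree 0, hence zero. In higher degree it is the
   boundary of some z, and z lifts to A1. *)
case: n x dx y1 y1E y2 y2E dz => [|n] x dx y1 y1E y2 y2E dz.
  exists y1; split=> //; apply/eqP; rewrite -subr_eq0; apply/eqP; exact: h120.
have [z zE] := h12 n _ dz; have [w wE] := surj n z.
exists (y1 - cx_d n w); split; first by rewrite raddfB /= cx_dd subr0.
by rewrite raddfB /= cm_d wE zE opprB addrC subrK.
Qed.

Section MvCone.
Variables (A A1 A2 A12 B B1 B2 B12 : complex).
Variables (r1 : chainMap A A1) (r2 : chainMap A A2).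
Variables (s1 : chainMap A1 A12) (s2 : chainMap A2 A12).
Variables (r1' : chainMap B B1) (r2' : chainMap B B2).
Variables (s1' : chainMap B1 B12) (s2' : chainMap B2 B12).
Variables (phi : chainMap A B) (phi1 : chainMap A1 B1) (phi2 : chainMap A2 B2).
Variable (phi12 : chainMap A12 B12).
Hypothesis e1 : forall n x, phi1 n (r1 n x) = r1' n (phi n x).
Hypothesis e2 : forall n x, phi2 n (r2 n x) = r2' n (phi n x).
Hypothesis e1' : forall n x, phi12 n (s1 n x) = s1' n (phi1 n x).
Hypothesis e2' : forall n x, phi12 n (s2 n x) = s2' n (phi2 n x).

Lemma mv_cone : mv_square r1 r2 s1 s2 -> mv_square r1' r2' s1' s2' ->
  mv_square (cone_map e1) (cone_map e2) (cone_map e1') (cone_map e2').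
Proof.
move=> [cA iA gA sA] [cB iB gB sB]; split=> [[|n] x|[|n] x|[|n] x1 x2|[|n] y] //=.
- exact: cA.
- by rewrite cA cB.
- exact: iA.
- by case: x => a b [ra1 rb1] [ra2 rb2]; congr (_, _); [apply: iA|apply: iB].
- exact: gA.
- case: x1 x2 => [a1 b1] [a2 b2] [/gA[a [<- <-]] /gB[b [<- <-]]].
  by exists (a, b).
- exact: sA.
- case: y => a b; have [a' <-] := sA n.+1 a; have [b' <-] := sB n b.
  by exists (a', b').
Qed.
End MvCone.

Section ResolutionCone.
Variables (A B : complex) (phi : chainMap A B) (A' B' : zmodType).
Variables (eA : {additive A' -> A 0%N}) (eB : {additive B' -> B 0%N}).
Variable phi' : A' -> B'.
Hypothesis phiE : forall x, phi 0%N (eA x) = eB (phi' x).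
Hypothesis exA0 : forall x, cx_d 0 x = 0 -> exists y, eA y = x.
Hypothesis exA : forall n (x : A n.+1), cx_d n.+1 x = 0 -> exists y, cx_d n y = x.
Hypothesis inB : forall x, eB x = 0 -> x = 0.
Hypothesis deA : forall x, cx_d 0 (eA x) = 0.
Hypothesis exB0 : forall x, cx_d 0 x = 0 -> exists y, eB y = x.
Hypothesis exB : forall n (x : B n.+1), cx_d n.+1 x = 0 -> exists y, cx_d n y = x.
Hypothesis inphi : forall x, phi' x = 0 -> x = 0.
Hypothesis surphi : forall y, exists x, phi' x = y.

(** Both complexes have cohomology in degree 0 only, where [phi] becomes the bijection [phi']. *)
Lemma resolution_cone_acyclic : acyclic (cone phi).
Proof.
apply/cone_acyclicP; split=> [a /exA0[x <-]|a b da|n a b da].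
- by rewrite phiE => /inB/inphi ->; rewrite raddf0.
- have [a1 <-] := exA da; rewrite cm_d => /eqP.
  rewrite eq_sym -subr_eq0 -raddfB => /eqP/exB0[y].
  have [x <-] := surphi y; rewrite -phiE => e.
  (* The preimage [a1] misses [b] by a cocycle of degree 0, which comes from B' and hence, through
     [phi'], from an element of A'. *)
  exists (a1 + eA x); rewrite !raddfD /= deA addr0; split => //.
  by rewrite e addrC subrK.
- have [a1 <-] := exA da; rewrite cm_d => /eqP.
  rewrite -subr_eq0 -raddfB => /eqP/exB[y e].
  by exists a1, y; split=> //; rewrite e opprB addrC subrK.
Qed.
End ResolutionCone.

(** * Injective sheaves on a finite space are flasque *)

Section Local.
Variables (k : comPzRingType) (Z : ringedFiniteSpace k).

Lemma Umin_sub (U : opens Z) x : oset U x -> Umin x `<=` U.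
Proof. by move=> Ux; apply: min_nbhs_sub => //; exact: oset_open. Qed.

(** Stated for a bare family of sections, so as to serve both modules and the structure sheaf. *)
Lemma sheaf_ext (F : opens Z -> Type) (res : forall U V : opens Z, V `<=` U -> F U -> F V) :
  (forall (U V W : opens Z) (hVU : V `<=` U) (hWV : W `<=` V) (hWU : W `<=` U) s,
    res _ _ hWV (res _ _ hVU s) = res _ _ hWU s) ->
  is_sheaf res -> forall (U : opens Z) (s t : F U),
  (forall x (Ux : oset U x), res _ _ (Umin_sub Ux) s = res _ _ (Umin_sub Ux) t) -> s = t.
Proof.
move=> res_comp sh U s t st.
have cov y : oset U y -> exists i : {x | oset U x}, oset (Umin (sval i)) y.
  by move=> Uy; exists (exist _ y Uy); exact: min_nbhs_self.
have [i j W hi hj|w [_ wU]] := sh _ _ _ (fun i : {x | oset U x} => Umin_sub (svalP i)) cov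
    (fun i => res _ _ (Umin_sub (svalP i)) s).
  by rewrite !(res_comp _ _ _ _ _ (subset_trans hi (Umin_sub (svalP i)))).
rewrite -(wU s) //; apply: wU => -[x Ux] /=; rewrite st.
by congr res; exact: Prop_irrelevance.
Qed.

Lemma msec_ext (F : modSheaf Z) (U : opens Z) (s t : F U) :
  (forall x (Ux : oset U x), ms_res (Umin_sub Ux) s = ms_res (Umin_sub Ux) t) -> s = t.
Proof. by apply: sheaf_ext; [exact: (@ms_res_comp _ F)|exact: ms_sheaf]. Qed.

Lemma rsec_ext (U : opens Z) (s t : rs_sec Z U) :
  (forall x (Ux : oset U x), rs_res (Umin_sub Ux) s = rs_res (Umin_sub Ux) t) -> s = t.
Proof.
move: s t; apply: (sheaf_ext (F := fun U => rs_sec Z U) (res := fun U V h => rs_res h)).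
  exact: rs_res_comp.
exact: rs_sheaf.
Qed.

Lemma msec_empty (F : modSheaf Z) (U : opens Z) (s : F U) :
  (forall x, ~ oset U x) -> s = 0.
Proof. by move=> U0; apply: msec_ext => x Ux; have := U0 x Ux. Qed.

End Local.

Lemma ms_res0 (X : ringedSpace) (F : modSheaf X) (U V : opens X) (h : V `<=` U) :
  ms_res h (0 : F U) = 0.
Proof. exact: (raddf0 (additive_of (ms_resD (m := F) h))). Qed.

Lemma ms_resB (X : ringedSpace) (F : modSheaf X) (U V : opens X) (h : V `<=` U)
    (s t : F U) :
  ms_res h (s - t) = ms_res h s - ms_res h t.
Proof. exact: (raddfB (additive_of (ms_resD (m := F) h))). Qed.

Section Godement.
Variables (k : comPzRingType) (Z : ringedFiniteSpace k) (F : modSheaf Z).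

Record godSec (U : opens Z) := GodSec { gs_val :> forall x, oset U x -> F (Umin x) }.

HB.instance Definition _ U := gen_eqMixin (godSec U).
HB.instance Definition _ U := gen_choiceMixin (godSec U).

Lemma godSecP U (s t : godSec U) : (forall x (Ux : oset U x), s x Ux = t x Ux) -> s = t.
Proof.
case: s t => s [t] /= st; congr GodSec.
by apply/functional_extensionality_dep => p; apply/funext.
Qed.

Section Ops.
Variable U : opens Z.
Implicit Types s t : godSec U.

Definition gs_zero : godSec U := GodSec (fun x _ => 0).
Definition gs_opp s : godSec U := GodSec (fun x Ux => - s x Ux).
Definition gs_add s t : godSec U := GodSec (fun x Ux => s x Ux + t x Ux).
Definition gs_scale (a : rs_sec Z U) s : godSec U :=
  GodSec (fun x Ux => rs_res (Umin_sub Ux) a *: s x Ux).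

Lemma gs_addA : associative gs_add.
Proof. by move=> x y z; apply: godSecP => p Up /=; rewrite addrA. Qed.
Lemma gs_addC : commutative gs_add.
Proof. by move=> x y; apply: godSecP => p Up /=; rewrite addrC. Qed.
Lemma gs_add0 : left_id gs_zero gs_add.
Proof. by move=> x; apply: godSecP => p Up /=; rewrite add0r. Qed.
Lemma gs_addN : left_inverse gs_zero gs_opp gs_add.
Proof. by move=> x; apply: godSecP => p Up /=; rewrite addNr. Qed.
HB.instance Definition _ := GRing.isZmodule.Build (godSec U)
  gs_addA gs_addC gs_add0 gs_addN.

Lemma gs_scaleA a b s : gs_scale a (gs_scale b s) = gs_scale (a * b) s.
Proof. by apply: godSecP => x Ux /=; rewrite scalerA rmorphM. Qed.
Lemma gs_scale1 : left_id 1 gs_scale.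
Proof. by move=> s; apply: godSecP => x Ux /=; rewrite rmorph1 scale1r. Qed.
Lemma gs_scaleDr : right_distributive gs_scale +%R.
Proof. by move=> a s t; apply: godSecP => x Ux /=; rewrite scalerDr. Qed.
Lemma gs_scaleDl s : {morph gs_scale^~ s : a b / a + b}.
Proof. by move=> a b; apply: godSecP => x Ux /=; rewrite rmorphD scalerDl. Qed.
HB.instance Definition _ := GRing.Zmodule_isLmodule.Build (rs_sec Z U) (godSec U)
  gs_scaleA gs_scale1 gs_scaleDr gs_scaleDl.
End Ops.

Definition gs_res (U V : opens Z) (h : V `<=` U) (s : godSec U) : godSec V :=
  GodSec (fun x Vx => s x (h x Vx)).

Lemma gs_resD (U V : opens Z) (h : V `<=` U) : {morph gs_res h : s t / s + t}.
Proof. by move=> s t; apply: godSecP. Qed.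
Lemma gs_resZ (U V : opens Z) (h : V `<=` U) (a : rs_sec Z U) (s : godSec U) :
  gs_res h (a *: s) = rs_res h a *: gs_res h s.
Proof.
apply: godSecP => x Vx /=; congr (_ *: _).
exact: (esym (rs_res_comp h (Umin_sub Vx) (Umin_sub (h x Vx)) a)).
Qed.
Lemma gs_res_id (U : opens Z) (h : U `<=` U) s : gs_res h s = s.
Proof. by apply: godSecP => x Ux /=; congr (gs_val s _); exact: Prop_irrelevance. Qed.
Lemma gs_res_comp (U V W : opens Z)
    (hVU : V `<=` U) (hWV : W `<=` V) (hWU : W `<=` U) s :
  gs_res hWV (gs_res hVU s) = gs_res hWU s.
Proof. by apply: godSecP => x Ux /=; congr (gs_val s _); exact: Prop_irrelevance. Qed.
Lemma gs_sheaf : is_sheaf gs_res.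
Proof.
move=> U I V VU cov s sP.
have sE i j p (hi : oset (V i) p) (hj : oset (V j) p) : s i p hi = s j p hj.
  pose W := Opens (openI (oset_open (V i)) (oset_open (V j))).
  have Wi : W `<=` V i by move=> y [].
  have Wj : W `<=` V j by move=> y [].
  have /= e := congr1 (fun t : godSec W => t p (conj hi hj)) (sP i j W Wi Wj).
  rewrite (Prop_irrelevance hi (Wi p (conj hi hj))) e.
  by congr (gs_val _ _); exact: Prop_irrelevance.
exists (GodSec (fun p Up => s _ p (projT2 (cid (cov p Up))))); split => [i|u uP].
  by apply: godSecP => p Vp /=; exact: sE.
apply: godSecP => p Up /=; rewrite -uP /=; congr (gs_val u _).
exact: Prop_irrelevance.
Qed.

Definition godement : modSheaf Z :=
  ModSheaf gs_resD gs_resZ gs_res_id gs_res_comp gs_sheaf.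

Definition gs_germ (U : opens Z) (s : F U) : godSec U :=
  GodSec (fun x Ux => ms_res (Umin_sub Ux) s).

Lemma gs_germ_linear U : linear (@gs_germ U).
Proof. by move=> a s t; apply: godSecP => x Ux /=; rewrite ms_resD ms_resZ. Qed.

Lemma gs_germ_natural (V W : opens Z) (hV : V `<=` oT Z) (hW : W `<=` oT Z)
    (h : W `<=` V) (s : F V) : gs_res h (gs_germ s) = gs_germ (ms_res h s).
Proof.
by apply: godSecP => x Wx /=; rewrite (ms_res_comp h (Umin_sub Wx) (Umin_sub (h x Wx))).
Qed.

Definition godement_germ : modHom F godement :=
  @ModHom Z (oT Z) F godement (fun V _ => linear_of (@gs_germ_linear V)) gs_germ_natural.

Lemma godement_germ_monic : monic_on godement_germ.
Proof.
move=> V hV s t /= e; apply: msec_ext => x Vx.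
exact: (congr1 (fun g : godSec V => g x Vx) e).
Qed.

(* F is a retract of the sheaf of discontinuous sections, which is flasque. *)
Lemma injective_flasque (U V : opens Z) (h : V `<=` U) : injective_sheaf F ->
  forall t : F V, exists s : F U, ms_res h s = t.
Proof.
move=> /(_ F godement godement_germ).
have idN (V' W : opens Z) (hV : V' `<=` oT Z) (hW : W `<=` oT Z) (h' : W `<=` V')
    (s : F V') :
  ms_res h' (idfun s) = idfun (ms_res h' s) by [].
pose idF : modHom F F :=
  @ModHom Z (oT Z) F F (fun V _ => idfun : {linear F V -> F V}) idN.
move=> /(_ idF godement_germ_monic)[w wE] t.
(* The germs of [t], extended by zero outside V: a discontinuous section obeys no compatibility, so
   any value is allowed there. *)
pose g : godement U := GodSec (fun x Ux => match pselect (oset V x) with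
  | left Vx => ms_res (Umin_sub Vx) t | right _ => 0 end).
exists (w U (@subsetT _ U) g); rewrite (mh_natural w _ (@subsetT _ V)).
rewrite -[RHS](wE V (@subsetT _ V) t); congr (w _ _ _).
apply: godSecP => x Vx /=; case: pselect => // Vx'.
by congr ms_res; exact: Prop_irrelevance.
Qed.
End Godement.

(** * Quasi-coherent sheaves: from presentations to base change *)

Section Fsum.
Variables (I : Type) (V : zmodType).
Implicit Types F G : I -> V.

(** Meaningful for families with [fin_support]; [{classic I}] gives the arbitrary index type the
    equality that finite sets require. *)
Definition fsum F : V := \big[+%R/0]_(i \in [set: {classic I}]) F i.

Definition fin_support F : Prop :=
  exists A : {fset {classic I}}, forall i, i \notin A -> F i = 0.

Lemma fsumE (A : {fset {classic I}}) F : (forall i, i \notin A -> F i = 0) ->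
  fsum F = \sum_(i <- A) F i.
Proof. exact: (fsbigTE (T := {classic I})). Qed.

Lemma fsumD F G : fin_support F -> fin_support G ->
  fsum (fun i => F i + G i) = fsum F + fsum G.
Proof.
move=> [A hA] [B hB]; rewrite !(fsumE (A := (A `|` B)%fset)) ?big_split // => i;
  rewrite in_fsetU negb_or => /andP[iA iB]; by rewrite ?hA ?hB ?addr0.
Qed.

Lemma fsum0 F : (forall i, F i = 0) -> fsum F = 0.
Proof. by move=> F0; exact: fsbig1. Qed.

Lemma eq_fsum F G : F =1 G -> fsum F = fsum G.
Proof. by move=> /funext ->. Qed.

End Fsum.

Lemma raddf_fsum (I : Type) (V W : zmodType) (h : {additive V -> W}) (F : I -> V) :
  fin_support F -> h (fsum F) = fsum (fun i => h (F i)).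
Proof.
move=> [A hA]; rewrite !(fsumE (A := A)) ?raddf_sum // => i iA.
by rewrite hA ?raddf0.
Qed.

Lemma fin_support_fset (I : Type) (D : set I) : finite_set D ->
  exists A : {fset {classic I}}, forall i : I, D i -> (i : {classic I}) \in A.
Proof.
move=> fD; exists (fset_set (D : set {classic I})) => i Di.
by rewrite in_fset_set //; apply/mem_set.
Qed.

Section Free.
Variables (k : comPzRingType) (Z : ringedFiniteSpace k) (I : Type).

(** A neighbourhood of x on which the support is finite contains [Umin x], and there are finitely
    many points x; thus local finiteness is finiteness, and sections of free sheaves are ordinary
    linear combinations. *)
Lemma free_support (U : opens Z) (s : freeSheaf Z I U) :
  exists A : {fset {classic I}}, forall i, i \notin A -> s i = 0.
Proof.
pose D (x : Z) : set I := [set i | exists Ux : oset U x, rs_res (Umin_sub Ux) (s i) != 0].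
have fD : finite_set (\bigcup_(x in [set: Z]) D x).
  apply: bigcup_finite; first exact: rfs_finite.
  move=> x _; have [Ux|nUx] := pselect (oset U x); last first.
    by rewrite (_ : D x = set0) //; apply/seteqP; split => // i [Ux _]; case: nUx.
  have [W [hW [Wx fW]]] := fs_finite s Ux.
  apply: sub_finite_set fW => i [Ux' nz] /=; apply: contraNN nz => /eqP e.
  by rewrite -(rs_res_comp hW (Umin_sub Wx)) e rmorph0.
have [A hA] := fin_support_fset fD; exists A => i; apply: contraNeq => si.
apply: hA; apply: contrapT => Di; move/eqP: si; apply.
apply: rsec_ext => x Ux; rewrite rmorph0; apply/eqP/negPn/negP => e.
by apply: Di; exists x => //; exists Ux.
Qed.

Lemma delta_subproof (U : opens Z) (i : I) : locally_finite
  (fun j => ((j : {classic I}) == (i : {classic I}))%:R : rs_sec Z U).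
Proof.
move=> x Ux; exists U, (@subset_refl _ U); split=> //.
apply: (sub_finite_set _ (finite_set1 i)) => j /=; apply: contraNP => ji.
by apply/eqP; case: eqP => [/ji//|_]; rewrite rmorph0.
Qed.

Definition delta (U : opens Z) (i : I) : freeSheaf Z I U := FreeSec (@delta_subproof U i).

Lemma deltaE (U : opens Z) i j :
  delta U i j = ((j : {classic I}) == (i : {classic I}))%:R.
Proof. by []. Qed.

Lemma res_delta (U V : opens Z) (h : V `<=` U) i : ms_res h (delta U i) = delta V i.
Proof. by apply: freeSecP => j /=; rewrite rmorph_nat. Qed.

Lemma fin_support_scale (U : opens Z) (N : lmodType (rs_sec Z U))
    (s : freeSheaf Z I U) (m : I -> N) : fin_support (fun i => s i *: m i).
Proof.
by have [A hA] := free_support s; exists A => i /hA ->; rewrite scale0r.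
Qed.

Lemma free_expand (U : opens Z) (s : freeSheaf Z I U) :
  s = fsum (fun i => s i *: delta U i).
Proof.
apply: freeSecP => j.
have cD : {morph (fun t : freeSheaf Z I U => t j) : s t / s + t} by [].
rewrite [RHS](raddf_fsum (additive_of cD)) /=; last exact: fin_support_scale.
rewrite (fsumE (A := [fset (j : {classic I})]%fset)) => [|i].
  by rewrite big_seq_fset1 eqxx mulr1.
by rewrite in_fset1 eq_sym => /negbTE ->; rewrite mulr0.
Qed.

Lemma free_hom_expand (U0 : opens Z) (N : modSheaf Z) (v : modHom_on U0 (freeSheaf Z I) N)
    (U : opens Z) (h : U `<=` U0) s :
  v U h s = fsum (fun i => s i *: v U h (delta U i)).
Proof.
rewrite {1}[s]free_expand raddf_fsum; last exact: fin_support_scale.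
by apply: eq_fsum => i; exact: linearZ.
Qed.

End Free.

Section MinOpen.
Variables (k : comPzRingType) (Z : ringedFiniteSpace k).

(** A property rather than the equality of [E] with [Umin z], because the open sets met on a product
    are minimal neighbourhoods without being of that form. *)
Definition min_open (E : opens Z) (z : Z) : Prop := oset E z /\ E `<=` min_nbhs z.

Lemma min_open_sub (E U : opens Z) z : min_open E z -> oset U z -> E `<=` U.
Proof. by move=> [_ Ez] Uz x /Ez; exact: Umin_sub. Qed.

Lemma Umin_min_open (z : Z) : min_open (Umin z) z.
Proof. by split=> //; exact: min_nbhs_self. Qed.

Variables (U : opens Z) (A B C : modSheaf Z).
Variables (u : modHom_on U A B) (v : modHom_on U B C).

(** Any neighbourhood of [z] on which [t] lifts contains [E]. This is why sections over a minimal
    open set behave as a stalk and form an exact functor. *)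
Lemma in_image_min (E : opens Z) z (h : E `<=` U) (t : B E) :
  min_open E z -> in_image u t -> exists s, u E h s = t.
Proof.
move=> Em /(_ z (proj1 Em)) [W [hWE [hWU [Wz [s sE]]]]].
have EW := min_open_sub Em Wz.
exists (ms_res EW s); rewrite -(mh_natural u hWU h EW) sE.
by rewrite (ms_res_comp hWE EW (@subset_refl _ E)) ms_res_id.
Qed.

Lemma exact_comp (V : opens Z) (h : V `<=` U) s : exact_on u v -> v V h (u V h s) = 0.
Proof.
move=> /(_ V h) ->; move=> x Vx.
exists V, (@subset_refl _ V), h; split=> //; exists s.
by rewrite ms_res_id.
Qed.

Lemma exact_min (E : opens Z) z (h : E `<=` U) (t : B E) :
  min_open E z -> exact_on u v -> v E h t = 0 -> exists s, u E h s = t.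
Proof. by move=> Em /(_ E h t) ex /ex im; exact: in_image_min Em im. Qed.

Lemma exact_minP (E : opens Z) z (h : E `<=` U) (t : B E) :
  min_open E z -> exact_on u v -> v E h t = 0 <-> exists s, u E h s = t.
Proof.
move=> Em ex; split=> [|[s <-]]; first exact: exact_min Em ex.
exact: exact_comp.
Qed.

Lemma monic_eq0 (V : opens Z) (h : V `<=` U) s : monic_on u -> u V h s = 0 -> s = 0.
Proof. by move=> /(_ V h) inj e; apply: inj; rewrite e raddf0. Qed.

Lemma epi_min (E : opens Z) z (h : E `<=` U) (t : B E) :
  min_open E z -> epi_on u -> exists s, u E h s = t.
Proof. by move=> Em /(_ E h t) im; exact: in_image_min Em im. Qed.

End MinOpen.

Section QuasiCoherent.
Variables (k : comPzRingType) (Z : ringedFiniteSpace k) (M : modSheaf Z).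
Hypothesis qcM : quasi_coherent M.
Variables (E F : opens Z) (z w : Z) (Ez : min_open E z) (Fw : min_open F w).
Variable (h : F `<=` E).

(** A presentation near [z] is available on all of [E], hence on [F], and the basis over [F] is the
    restriction of the basis over [E]. *)
Lemma qc_span (m : M F) : exists l : seq (rs_sec Z F * M E),
  m = \sum_(p <- l) p.1 *: ms_res h p.2.
Proof.
have [U [Uz [I [J [u [v [uv ve]]]]]]] := qcM z.
have EU := min_open_sub Ez Uz; have FU := subset_trans h EU.
have [e <-] := epi_min FU m Fw ve.
have [A hA] := free_support e.
exists [seq (e i, v E EU (delta E i)) | i <- A].
rewrite free_hom_expand (fsumE (A := A)) => [|i /hA ->]; last by rewrite scale0r.
by rewrite big_map; apply: eq_bigr => i _ /=; rewrite (mh_natural v EU FU) res_delta.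
Qed.

(* M F has the universal property of the tensor product of M E with the ring of F. *)
Lemma qc_universal (T : zmodType) (theta : rs_sec Z F -> M E -> T) :
  (forall s t m, theta (s + t) m = theta s m + theta t m) ->
  (forall s m n, theta s (m + n) = theta s m + theta s n) ->
  (forall s c m, theta (s * rs_res h c) m = theta s (c *: m)) ->
  exists psi : {additive M F -> T}, forall s m, psi (s *: ms_res h m) = theta s m.
Proof.
move=> tDl tDr tZ.
have [U [Uz [I [J [u [v [uv ve]]]]]]] := qcM z.
have EU := min_open_sub Ez Uz; have FU := subset_trans h EU.
pose thetal s := additive_of (tDr s).
have t0l m : theta 0 m = 0 by apply: (addIr (theta 0 m)); rewrite -tDl !add0r.
have t0r s : theta s 0 = 0 := raddf0 (thetal s).
pose g i := v E EU (delta E i).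
pose Psi (e : freeSheaf Z I F) := fsum (fun i => theta (e i) (g i)).
have fin (e : freeSheaf Z I F) : fin_support (fun i => theta (e i) (g i)).
  by have [A hA] := free_support e; exists A => i /hA ->.
have PsiD : {morph Psi : x y / x + y}.
  by move=> x y; rewrite /Psi -fsumD //; apply: eq_fsum => i; exact: tDl.
have PsiZ s (e : freeSheaf Z I E) : Psi (s *: ms_res h e) = theta s (v E EU e).
  rewrite free_hom_expand [RHS](raddf_fsum (thetal s)); last exact: fin_support_scale.
  by apply: eq_fsum => i /=; rewrite -tZ.
(* Relations over [F] are combinations of images of basis vectors under [u]; these are restricted
   from [E], where [v] already kills them, so [Psi] descends along [v]. *)
have PsiU e : v F FU e = 0 -> Psi e = 0.
  move=> /(exact_min Fw uv)[d <-]; rewrite free_hom_expand.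
  rewrite [LHS](raddf_fsum (additive_of PsiD)); last exact: fin_support_scale.
  apply: fsum0 => i /=.
  by rewrite -(res_delta h) -(mh_natural u EU FU) PsiZ (exact_comp _ _ uv).
pose lift m := projT1 (cid (epi_min FU m Fw ve)).
have liftK m : v F FU (lift m) = m by rewrite /lift; case: cid.
have Psi_lift e : Psi (lift (v F FU e)) = Psi e.
  apply/eqP; rewrite -subr_eq0 -(raddfB (additive_of PsiD)) /=; apply/eqP/PsiU.
  by rewrite linearB liftK subrr.
have psiD : {morph (fun m => Psi (lift m)) : x y / x + y}.
  by move=> x y; rewrite -PsiD -(Psi_lift (_ + _)) linearD !liftK.
exists (additive_of psiD) => s m /=.
have [e <-] := epi_min EU m Ez ve.
rewrite -PsiZ -[RHS]Psi_lift (mh_natural v EU FU); congr (Psi (lift _)).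
by apply/esym; exact: linearZ.
Qed.
End QuasiCoherent.

(** * Quasi-coherent sheaves: from base change to presentations *)

Section FreeHom.
Variables (k : comPzRingType) (Z : ringedFiniteSpace k) (I : Type) (N : modSheaf Z).
Variables (U : opens Z) (g : I -> N U).

Definition free_hom_fun (V : opens Z) (h : V `<=` U) (s : freeSheaf Z I V) : N V :=
  fsum (fun i => s i *: ms_res h (g i)).

Lemma free_hom_linear (V : opens Z) (h : V `<=` U) : linear (free_hom_fun h).
Proof.
move=> a s t.
have sZ : {morph (fun x : N V => a *: x) : x y / x + y} by exact: scalerDr.
have -> : a *: free_hom_fun h s = fsum (fun i => a *: (s i *: ms_res h (g i))).
  by rewrite -[LHS]/(additive_of sZ _) raddf_fsum //; exact: fin_support_scale.
rewrite -fsumD /=; last exact: fin_support_scale.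
  by apply: eq_fsum => i; rewrite scalerDl scalerA.
have [A hA] := free_support s.
by exists A => i /hA ->; rewrite scale0r scaler0.
Qed.

Lemma free_hom_natural (V W : opens Z) (hVU : V `<=` U) (hWU : W `<=` U)
    (hWV : W `<=` V) (s : freeSheaf Z I V) :
  ms_res hWV (free_hom_fun hVU s) = free_hom_fun hWU (ms_res hWV s).
Proof.
rewrite [LHS](raddf_fsum (additive_of (ms_resD (m := N) hWV))); last first.
  exact: fin_support_scale.
by apply: eq_fsum => i /=; rewrite ms_resZ (ms_res_comp hVU hWV hWU).
Qed.

Definition free_hom : modHom_on U (freeSheaf Z I) N :=
  @ModHom Z U (freeSheaf Z I) N
    (fun V h => linear_of (free_hom_linear h)) free_hom_natural.

Lemma free_hom_delta (V : opens Z) (h : V `<=` U) i :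
  free_hom V h (delta V i) = ms_res h (g i).
Proof.
rewrite /= /free_hom_fun (fsumE (A := [fset (i : {classic I})]%fset)) => [|j].
  by rewrite big_seq_fset1 deltaE eqxx scale1r.
by rewrite in_fset1 deltaE => /negbTE ->; rewrite scale0r.
Qed.
End FreeHom.

Section ResLin.
Variables (k : comPzRingType) (Z : ringedFiniteSpace k) (N : modSheaf Z).
Variables (U V : opens Z) (h : V `<=` U).

Let res_linear : linear (ms_res h : N U -> restrict_scalars (rs_res h) (N V)).
Proof. by move=> a s t; rewrite ms_resD ms_resZ. Qed.

Definition res_lin : {linear N U -> restrict_scalars (rs_res h) (N V)} :=
  linear_of res_linear.

Definition base_change_iso : Prop :=
  (forall t, bce res_lin t = 0 -> t = 0) /\ (forall y, exists t, bce res_lin t = y).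
End ResLin.

Section Presentation.
Variables (k : comPzRingType) (Z : ringedFiniteSpace k) (N : modSheaf Z).
Hypothesis bcN : forall (p q : Z) (h : Umin q `<=` Umin p), base_change_iso N h.

Section AtPoint.
Variable x : Z.
Local Notation U := (Umin x).

Let v := free_hom (fun n : N U => n).
Let I : Type := N U.
Let J : Type := {e : freeSheaf Z I U | v U (@subset_refl _ U) e = 0}.
Let u : modHom_on U (freeSheaf Z J) (freeSheaf Z I) := free_hom (fun j : J => sval j).

Let vu0 (V : opens Z) (h : V `<=` U) s : v V h (u V h s) = 0.
Proof.
rewrite (free_hom_expand u) raddf_fsum; last exact: fin_support_scale.
apply: fsum0 => j; apply: etrans (linearZ _ _) _.
rewrite free_hom_delta -(mh_natural v (@subset_refl _ U) h) (svalP j).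
by rewrite ms_res0; exact: scaler0.
Qed.

(** The relations over U_x generate those over U_y: modulo them, the class of [e] is the image,
    under a map out of the base change of N_x, of the sum of the e_n (x) n. That sum goes to 0 in
    N_y, so it vanishes by injectivity of the base change map. *)
Let ker_v (y : Z) (h : Umin y `<=` U) (e : freeSheaf Z I (Umin y)) :
  v (Umin y) h e = 0 -> exists s, u (Umin y) h s = e.
Proof.
set W := Umin y => ve.
have [||Q [pi [_ piP]]] := @quotient_module (rs_sec Z W) (freeSheaf Z I W)
    (fun e => exists s, u W h s = e).
- by exists 0; rewrite raddf0.
- by move=> a _ _ [s <-] [t <-]; exists (a *: s + t); rewrite linearP.
apply/piP.
have piE (d : freeSheaf Z I U) : v U (@subset_refl _ U) d = 0 -> pi (ms_res h d) = 0.
  move=> d0; apply/piP; exists (delta W (exist _ d d0 : J)).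
  exact: free_hom_delta.
have vd n : v U (@subset_refl _ U) (delta U n) = n.
  by rewrite free_hom_delta ms_res_id.
(* Every element of N_x indexes a basis vector, so the module laws of N_x are themselves relations
   over U_x, and sending n to the class of its basis vector is linear. *)
have piD m n : pi (delta W (m + n : N U)) = pi (delta W m) + pi (delta W n).
  apply/eqP; rewrite -subr_eq0 -raddfD -raddfB -!(res_delta h) -ms_resD -ms_resB.
  by apply/eqP/piE; rewrite linearB linearD !vd subrr.
have piZ a n : pi (delta W (a *: n : N U)) = rs_res h a *: pi (delta W n).
  apply/eqP; rewrite -subr_eq0 -linearZ -raddfB -!(res_delta h) -ms_resZ -ms_resB.
  by apply/eqP/piE; rewrite linearB linearZ !vd subrr.
pose b (s : restrict_scalars (rs_res h) (rs_sec Z W)^o) (n : N U) :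
  restrict_scalars (rs_res h) Q := (s : rs_sec Z W) *: pi (delta W n).
have bil : is_bilinear b.
  split=> [s t n|s m n|a s n|a s n]; rewrite /b.
  - exact: (@scalerDl _ Q (pi (delta W n)) s t).
  - by rewrite piD; exact: (@scalerDr _ Q s).
  - exact: (esym (@scalerA _ Q (rs_res h a) s _)).
  - rewrite piZ; apply: (etrans (@scalerA _ Q s (rs_res h a) _)); rewrite mulrC.
    exact: (esym (@scalerA _ Q (rs_res h a) s _)).
have [w wE] := bc_lift bil.
have fin : fin_support (fun n => bcpure (rs_res h) (e n) (n : N U)).
  have [A hA] := free_support e; exists A => n /hA ->.
  by apply: (addIr (bcpure (rs_res h) 0 (n : N U))); rewrite -bcpureDl !add0r.
have t0 : fsum (fun n => bcpure (rs_res h) (e n) (n : N U)) = 0.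
  apply: (proj1 (bcN h)); rewrite raddf_fsum // -[RHS]ve.
  by apply: eq_fsum => n; rewrite bceE.
rewrite [e]free_expand raddf_fsum; last exact: fin_support_scale.
rewrite -[RHS](raddf0 w) -t0 raddf_fsum //.
apply: eq_fsum => n; apply: etrans (linearZ _ _) _; apply/esym; exact: wE.
Qed.

Lemma presentation_at : exists (I J : Type) (u : modHom_on U (freeSheaf Z J) (freeSheaf Z I))
  (v : modHom_on U (freeSheaf Z I) N), exact_on u v /\ epi_on v.
Proof.
exists I, J, u, v; split=> [V h t|V h t y Vy].
  split=> [vt y Vy|im].
    have hW := subset_trans (Umin_sub Vy) h.
    exists (Umin y), (Umin_sub Vy), hW; split; first exact: min_nbhs_self.
    by apply: ker_v; rewrite -(mh_natural v h) vt ms_res0.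
  apply: msec_ext => y Vy.
  have hW := subset_trans (Umin_sub Vy) h.
  rewrite (mh_natural v h hW); have [W [hWV [hWU [Wy [s sE]]]]] := im y Vy.
  rewrite -(ms_res_comp hWV (Umin_sub Wy)) -sE (mh_natural u hWU hW) vu0.
  by rewrite ms_res0.
have hW := subset_trans (Umin_sub Vy) h.
exists (Umin y), (Umin_sub Vy), hW; split; first exact: min_nbhs_self.
(* Surjectivity of the base change map: N_y is spanned by restrictions of elements of N_x, each the
   image of a basis vector. *)
have [tt <-] := proj2 (bcN hW) (ms_res (Umin_sub Vy) t).
have [l ->] := bc_sum tt.
exists (\sum_(p <- l) p.1 *: delta (Umin y) (p.2 : I)).
rewrite !raddf_sum; apply: eq_bigr => p _.
rewrite bceE; apply: etrans (linearZ _ _) _; congr (_ *: _).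
exact: free_hom_delta.
Qed.
End AtPoint.

Theorem base_change_quasi_coherent : quasi_coherent N.
Proof.
move=> x; exists (Umin x); split; first exact: min_nbhs_self.
exact: presentation_at.
Qed.
End Presentation.

(** * Base change and cohomology *)

Record modComplex (R : pzRingType) := ModComplex {
  mc_obj :> nat -> lmodType R;
  mc_d : forall n, {linear mc_obj n -> mc_obj n.+1};
  mc_dd : forall n x, mc_d n.+1 (mc_d n x) = 0 }.

Arguments mc_d {R m} n.

Definition mc_forget (R : pzRingType) (C : modComplex R) : complex :=
  @Complex (fun n => C n) (fun n => mc_d n) (@mc_dd R C).

Record linMap (R : pzRingType) (C D : modComplex R) := LinMap {
  lm_fun :> forall n, {linear C n -> D n};
  lm_d : forall n x, lm_fun n.+1 (mc_d n x) = mc_d n (lm_fun n x) }.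

Definition lm_forget (R : pzRingType) (C D : modComplex R) (u : linMap C D) :
  chainMap (mc_forget C) (mc_forget D) :=
  @ChainMap (mc_forget C) (mc_forget D) (fun n => u n) (lm_d u).

Record semiMap (R S : pzRingType) (f : {rmorphism R -> S}) (C : modComplex R)
    (D : modComplex S) := SemiMap {
  sm_fun :> forall n, {linear C n -> restrict_scalars f (D n)};
  sm_d : forall n x, sm_fun n.+1 (mc_d n x) = mc_d n (sm_fun n x : D n) }.

Section ComplexBaseChange.
Variables (R S : comPzRingType) (f : {rmorphism R -> S}).

Lemma bc_dd (C : modComplex R) n t : bcm f (mc_d n.+1) (bcm f (@mc_d R C n) t) = 0.
Proof.
apply: etrans (bcm0 (u := \0 : {linear C n -> C n.+2}) _ t) => //.
by apply: bcm_comp => x; rewrite mc_dd.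
Qed.

Definition bc_complex (C : modComplex R) : complex :=
  @Complex (fun n => bc f (C n)) (fun n => bcm f (mc_d n)) (bc_dd (C := C)).

Section BcLinMap.
Variables (C D : modComplex R) (u : linMap C D).
Let bc_lin_d n t : bcm f (u n.+1) (bcm f (mc_d n) t) = bcm f (mc_d n) (bcm f (u n) t).
Proof.
move: t; apply: (bc_ext (h := bcm f (u n.+1) \o bcm f (mc_d n))
  (h' := bcm f (mc_d n) \o bcm f (u n))) => s x /=.
by rewrite !bcmE lm_d.
Qed.
Definition bc_lin : chainMap (bc_complex C) (bc_complex D) :=
  @ChainMap (bc_complex C) (bc_complex D) (fun n => bcm f (u n)) bc_lin_d.
End BcLinMap.

Section BcSemiMap.
Variables (C : modComplex R) (D : modComplex S) (rho : semiMap f C D).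

Let bc_semi_d n t : bce (rho n.+1) (bcm f (mc_d n) t) = mc_d n (bce (rho n) t).
Proof.
move: t; apply: (bc_ext (h := bce (rho n.+1) \o bcm f (mc_d n))
  (h' := (mc_d n : {additive _ -> _}) \o bce (rho n))) => s x /=.
by rewrite bcmE !bceE sm_d linearZ.
Qed.
Definition bc_semi : chainMap (bc_complex C) (mc_forget D) :=
  @ChainMap (bc_complex C) (mc_forget D) (fun n => bce (rho n)) bc_semi_d.

Definition bc_quasi_iso : Prop := acyclic (cone bc_semi).
End BcSemiMap.

Lemma bce_natural (M N : lmodType R) (M' N' : lmodType S)
    (rM : {linear M -> restrict_scalars f M'}) (rN : {linear N -> restrict_scalars f N'})
    (u : {linear M -> N}) (u' : {linear M' -> N'}) :
  (forall x, rN (u x) = u' (rM x)) -> forall t, bce rN (bcm f u t) = u' (bce rM t).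
Proof.
move=> e; apply: (bc_ext (h := bce rN \o bcm f u)
  (h' := (u' : {additive _ -> _}) \o bce rM)) => s x /=.
by rewrite bcmE !bceE e linearZ.
Qed.

Hypothesis flatf : flat f.

(** Injectivity and gluing survive by flatness, the surjectivity of [s1] by right exactness. *)
Lemma mv_bc (C C1 C2 C12 : modComplex R) (r1 : linMap C C1) (r2 : linMap C C2)
    (s1 : linMap C1 C12) (s2 : linMap C2 C12) :
  mv_square (lm_forget r1) (lm_forget r2) (lm_forget s1) (lm_forget s2) ->
  mv_square (bc_lin r1) (bc_lin r2) (bc_lin s1) (bc_lin s2).
Proof.
move=> [comm inj glue surj]; split=> n /=.
- move=> t; rewrite (bcm_comp (w := s1 n \o r1 n)) //.
  by apply/esym/bcm_comp => x; apply/esym; exact: comm.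
- exact: (bcm_joint_inj flatf (inj n)).
- exact: (bcm_glue flatf (glue n)).
- by apply: bcm_surj => y; exact: surj.
Qed.

Section Cohomology.
Variables (C : modComplex R) (D : modComplex S) (rho : semiMap f C D).
Hypothesis qi : bc_quasi_iso rho.

Lemma quasi_iso_inj n (a : bc f (C n.+1)) (b : D n) :
  bcm f (mc_d n.+1) a = 0 -> bce (rho n.+1) a = mc_d n b ->
  exists a', bcm f (mc_d n) a' = a.
Proof.
have /cone_acyclicP [_ h1 h2] := qi.
case: n a b => [|n] a b da ra; first by have [a' [a'E _]] := h1 a b da ra; exists a'.
by have [a' [b' [a'E _]]] := h2 n a b da ra; exists a'.
Qed.

(** Exactness of the cone at the cocycle (0, b). *)
Lemma quasi_iso_surj n (b : D n.+1) : mc_d n.+1 b = 0 ->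
  exists a b', bcm f (mc_d n.+1) a = 0 /\ bce (rho n.+1) a - mc_d n b' = b.
Proof.
have /cone_acyclicP [_ _ h2] := qi => db.
have [||a [b' [da ab]]] := h2 n 0 b; first exact: raddf0.
  by rewrite [RHS]db; exact: raddf0.
by exists a, b'.
Qed.

Variables (N : lmodType R) (N' : lmodType S) (rN : {linear N -> restrict_scalars f N'}).

(** By flatness the base change of N is the kernel of the tensored differential, that is H^0 of
    [bc_complex C], which the quasi-isomorphism identifies with H^0 of D. *)
Lemma kernel_base_change (j : {linear N -> C 0%N}) (j' : {linear N' -> D 0%N}) :
  (forall x, j x = 0 -> x = 0) -> (forall x, mc_d 0 x = 0 <-> exists y, j y = x) ->
  (forall x, j' x = 0 -> x = 0) -> (forall x, mc_d 0 x = 0 <-> exists y, j' y = x) ->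
  (forall x, rho 0%N (j x) = j' (rN x)) ->
  (forall t, bce rN t = 0 -> t = 0) /\ (forall y, exists t, bce rN t = y).
Proof.
move=> j0 jex j'0 j'ex jj'.
have nat := bce_natural jj'.
have dj t : bcm f (mc_d 0) (bcm f j t) = 0.
  apply: etrans (bcm0 (u := \0 : {linear N -> C 1%N}) _ t) => //.
  by apply: bcm_comp => x; apply/jex; exists x.
have /cone_acyclicP [h0 h1 _] := qi; split=> [t rt|y].
  by apply: (bcm_inj flatf j0); apply: h0 => //=; rewrite nat rt raddf0.
have [||a [da ra]] := h1 0 (j' y); first exact: raddf0.
  by apply: etrans (raddf0 _) _; apply/esym/j'ex; exists y.
have [|t tE] := bcm_exact flatf (u := j) (v := mc_d 0) _ da; first by move=> b /jex.
exists t; apply/eqP; rewrite -subr_eq0; apply/eqP/j'0.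
by rewrite linearB -nat tE [bce _ _]ra subrr.
Qed.

Variables (n : nat) (K : lmodType R) (K' : lmodType S).
Variable rK : {linear K -> restrict_scalars f K'}.

(** Here K is the module of cocycles and N its cokernel by the boundaries. Flatness keeps K the
    module of cocycles after tensoring, right exactness keeps N the cokernel, and the
    quasi-isomorphism then compares the cohomology in degree n+1. *)
Lemma cohomology_base_change
    (j : {linear K -> C n.+1}) (j' : {linear K' -> D n.+1})
    (a : {linear C n -> K}) (a' : {linear D n -> K'})
    (p : {linear K -> N}) (p' : {linear K' -> N'}) :
  (forall x, j x = 0 -> x = 0) -> (forall x, mc_d n.+1 x = 0 <-> exists y, j y = x) ->
  (forall x, j' x = 0 -> x = 0) -> (forall x, mc_d n.+1 x = 0 <-> exists y, j' y = x) ->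
  (forall x, j (a x) = mc_d n x) -> (forall x, j' (a' x) = mc_d n x) ->
  (forall x, p x = 0 <-> exists y, a y = x) -> (forall y, exists x, p x = y) ->
  (forall x, p' x = 0 <-> exists y, a' y = x) -> (forall y, exists x, p' x = y) ->
  (forall x, rho n.+1 (j x) = j' (rK x)) -> (forall x, rN (p x) = p' (rK x)) ->
  (forall t, bce rN t = 0 -> t = 0) /\ (forall y, exists t, bce rN t = y).
Proof.
move=> j0 jex j'0 j'ex ja j'a' pex ps p'ex p's jj' pp'.
have natj := bce_natural jj'; have natp := bce_natural pp'.
have dj t : bcm f (mc_d n.+1) (bcm f j t) = 0.
  apply: etrans (bcm0 (u := \0 : {linear K -> C n.+2}) _ t) => //.
  by apply: bcm_comp => x; apply/jex; exists x.
have pa t : bcm f p (bcm f a t) = 0.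
  apply: etrans (bcm0 (u := \0 : {linear C n -> N}) _ t) => //.
  by apply: bcm_comp => x; apply/pex; exists x.
split=> [t rt|y].
  have [k kE] := bcm_surj ps t.
  move: rt; rewrite -kE natp => /p'ex[b bE].
  have [|c cE] := quasi_iso_inj (b := b) (dj k); first by rewrite natj -bE j'a'.
  suff -> : k = bcm f a c by exact: pa.
  apply/eqP; rewrite -subr_eq0; apply/eqP/(bcm_inj flatf j0).
  by rewrite linearB /= (bcm_comp (w := mc_d n)) // cE subrr.
have [k <-] := p's y.
have [|c [b [dc cb]]] := @quasi_iso_surj n (j' k); first by apply/j'ex; exists k.
have [|t tE] := bcm_exact flatf (u := j) (v := mc_d n.+1) _ dc; first by move=> x /jex.
exists (bcm f p t); rewrite natp; apply/eqP; rewrite -subr_eq0 -linearB; apply/eqP/p'ex.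
exists b; apply/eqP; rewrite -subr_eq0; apply/eqP/j'0.
by rewrite (linearB j') (linearB j') j'a' -natj tE -cb subKr subrr.
Qed.
End Cohomology.
End ComplexBaseChange.

(** * Mayer-Vietoris for the sections of an injective resolution *)

Definition rs_lin (R S : pzRingType) (a : {rmorphism R -> S}) (M N : lmodType S)
  (u : {linear M -> N}) : {linear restrict_scalars a M -> restrict_scalars a N} :=
  @linear_of R (restrict_scalars a M) (restrict_scalars a N) u
    (fun r x y => linearP u (a r) x y).

Section SectionsMayerVietoris.
Variables (k : comPzRingType) (Z : ringedFiniteSpace k) (G : modSheaf Z).
Variables (U U1 U2 U12 : opens Z).
Variables (h1 : U1 `<=` U) (h2 : U2 `<=` U) (g1 : U12 `<=` U1) (g2 : U12 `<=` U2).
Hypothesis cover : forall x, oset U x -> oset U1 x \/ oset U2 x.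
Hypothesis cap : forall x, oset U1 x -> oset U2 x -> oset U12 x.

Lemma sections_mv_comm (s : G U) : ms_res g1 (ms_res h1 s) = ms_res g2 (ms_res h2 s).
Proof. by rewrite !(ms_res_comp _ _ (subset_trans g1 h1)). Qed.

Lemma sections_mv_inj (s : G U) : ms_res h1 s = 0 -> ms_res h2 s = 0 -> s = 0.
Proof.
move=> s1 s2; apply: msec_ext => x Ux; rewrite ms_res0.
have [U1x|U2x] := cover Ux.
  by rewrite -(ms_res_comp h1 (Umin_sub U1x)) s1 ms_res0.
by rewrite -(ms_res_comp h2 (Umin_sub U2x)) s2 ms_res0.
Qed.

Lemma sections_mv_glue (s1 : G U1) (s2 : G U2) : ms_res g1 s1 = ms_res g2 s2 ->
  exists s, ms_res h1 s = s1 /\ ms_res h2 s = s2.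
Proof.
move=> e.
pose V (b : bool) := if b then U1 else U2.
have VU b : V b `<=` U by case: b.
pose s b : G (V b) := match b with true => s1 | false => s2 end.
have [x Ux|i j W hi hj|t [tE _]] := ms_sheaf VU _ (s := s).
- by have [?|?] := cover Ux; [exists true|exists false].
- have cmp b (h h' : W `<=` V b) : ms_res h (s b) = ms_res h' (s b).
    by congr ms_res; exact: Prop_irrelevance.
  have e12 (h : W `<=` U1) (h' : W `<=` U2) : ms_res h s1 = ms_res h' s2.
    have W12 : W `<=` U12 by move=> x Wx; apply: cap; [exact: h|exact: h'].
    by rewrite -(ms_res_comp g1 W12) e (ms_res_comp g2 W12 h').
  by case: i j hi hj => [] [] hi hj; [exact: cmp|exact: e12|apply/esym/e12|exact: cmp].
- exists t; split; [rewrite -[RHS](tE true)|rewrite -[RHS](tE false)];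
    by congr ms_res; exact: Prop_irrelevance.
Qed.
End SectionsMayerVietoris.

(** * Comparison of the complexes of sections over a pair of open sets *)

Section Charts.
Variables (k : comPzRingType) (Z : ringedFiniteSpace k).
Variables (R S : comPzRingType) (f : {rmorphism R -> S}).

(* ch_E and ch_F stand for U_p x W and U_q x W, while R and S stand for O_p and O_q. *)
Record chart := Chart {
  ch_E : opens Z; ch_F : opens Z; ch_sub : ch_F `<=` ch_E;
  ch_a : {rmorphism R -> rs_sec Z ch_E};
  ch_b : {rmorphism S -> rs_sec Z ch_F};
  ch_ab : forall r, rs_res ch_sub (ch_a r) = ch_b (f r) }.

Arguments ch_sub : clear implicits.

(** Compatibility with the structure maps makes the restrictions linear over the fixed rings R and
    S, whatever W is. *)
Record chartMap (c c' : chart) := ChartMap {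
  chm_E : ch_E c' `<=` ch_E c; chm_F : ch_F c' `<=` ch_F c;
  chm_a : forall r, rs_res chm_E (ch_a c r) = ch_a c' r;
  chm_b : forall s, rs_res chm_F (ch_b c s) = ch_b c' s }.

Arguments chm_E {c c'} m : rename.
Arguments chm_F {c c'} m : rename.

Lemma restrict_chart (c : chart) (E F : opens Z) : E `<=` ch_E c -> F `<=` ch_F c ->
  F `<=` E -> exists c' : chart,
    [/\ ch_E c' = E, ch_F c' = F & inhabited (chartMap c c')].
Proof.
move=> hE hF hFE.
have ab r : rs_res hFE ((rs_res hE \o ch_a c) r) = (rs_res hF \o ch_b c) (f r).
  rewrite /= -ch_ab (rs_res_comp hE hFE (subset_trans hFE hE)).
  by rewrite (rs_res_comp (ch_sub c) hF (subset_trans hFE hE)).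
by exists (Chart ab); split => //; exists; exists hE hF.
Qed.

Lemma chart_map_trans (c c' c'' : chart) :
  chartMap c c' -> chartMap c' c'' -> chartMap c c''.
Proof.
move=> [hE hF ha hb] [hE' hF' ha' hb'].
exists (subset_trans hE' hE) (subset_trans hF' hF) => x.
  by rewrite -(rs_res_comp hE hE') ha.
by rewrite -(rs_res_comp hF hF') hb.
Qed.

Lemma chart_map_factor (c c1 c2 : chart) : chartMap c c1 -> chartMap c c2 ->
  ch_E c2 `<=` ch_E c1 -> ch_F c2 `<=` ch_F c1 -> chartMap c1 c2.
Proof.
move=> [hE hF ha hb] [hE' hF' ha' hb'] sE sF.
exists sE sF => x; first by rewrite -ha (rs_res_comp hE sE hE') ha'.
by rewrite -hb (rs_res_comp hF sF hF') hb'.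
Qed.

Definition mod_E (c : chart) (G : modSheaf Z) : lmodType R :=
  restrict_scalars (ch_a c) (G (ch_E c)).
Definition mod_F (c : chart) (G : modSheaf Z) : lmodType S :=
  restrict_scalars (ch_b c) (G (ch_F c)).

Section Resolution.
Variables (M : modSheaf Z) (I : injectiveResolution M).
Local Notation sT := (@subsetT _ _).

Lemma ir_dd n (U : opens Z) (h : U `<=` oT Z) s :
  ir_d I n.+1 U h (ir_d I n U h s) = 0.
Proof. by apply: exact_comp; exact: ir_exactS. Qed.

Lemma ir_d_aug (U : opens Z) (h : U `<=` oT Z) s : ir_d I 0%N U h (ir_aug I U h s) = 0.
Proof. by apply: exact_comp; exact: ir_exact0. Qed.

Definition cx_E (c : chart) : modComplex R :=
  @ModComplex R (fun n => mod_E c (ir_term I n))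
    (fun n => rs_lin (ch_a c) (ir_d I n (ch_E c) sT)) (fun n => ir_dd (n := n) sT).
Definition cx_F (c : chart) : modComplex S :=
  @ModComplex S (fun n => mod_F c (ir_term I n))
    (fun n => rs_lin (ch_b c) (ir_d I n (ch_F c) sT)) (fun n => ir_dd (n := n) sT).

Section Rho.
Variables (c : chart) (G : modSheaf Z).
Let rho_linear : linear (fun s : mod_E c G =>
  ms_res (ch_sub c) (s : G (ch_E c)) : restrict_scalars f (mod_F c G)).
Proof. by move=> r s t; rewrite [LHS]ms_resD ms_resZ ch_ab. Qed.
Definition chart_rho : {linear mod_E c G -> restrict_scalars f (mod_F c G)} :=
  linear_of rho_linear.
End Rho.

Definition cx_rho (c : chart) : semiMap f (cx_E c) (cx_F c) :=
  @SemiMap R S f (cx_E c) (cx_F c) (fun n => chart_rho c (ir_term I n))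
    (fun n x => mh_natural (ir_d I n) sT sT (ch_sub c) x).

Definition good (c : chart) : Prop := bc_quasi_iso (cx_rho c).

Section Maps.
Variables (c c' : chart) (m : chartMap c c').
Section MapSheaf.
Variable G : modSheaf Z.
Let map_E_linear : linear (fun s : mod_E c G =>
  ms_res (chm_E m) (s : G (ch_E c)) : mod_E c' G).
Proof. by move=> r s t; rewrite [LHS]ms_resD ms_resZ chm_a. Qed.
Definition map_E : {linear mod_E c G -> mod_E c' G} := linear_of map_E_linear.
Let map_F_linear : linear (fun s : mod_F c G =>
  ms_res (chm_F m) (s : G (ch_F c)) : mod_F c' G).
Proof. by move=> r s t; rewrite [LHS]ms_resD ms_resZ chm_b. Qed.
Definition map_F : {linear mod_F c G -> mod_F c' G} := linear_of map_F_linear.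
End MapSheaf.

Definition cx_map_E : linMap (cx_E c) (cx_E c') :=
  @LinMap R (cx_E c) (cx_E c') (fun n => map_E (ir_term I n))
    (fun n x => mh_natural (ir_d I n) sT sT (chm_E m) x).
Definition cx_map_F : linMap (cx_F c) (cx_F c') :=
  @LinMap S (cx_F c) (cx_F c') (fun n => map_F (ir_term I n))
    (fun n x => mh_natural (ir_d I n) sT sT (chm_F m) x).

Lemma cx_map_rho n t : bc_semi (cx_rho c') n (bc_lin f cx_map_E n t) =
  lm_forget cx_map_F n (bc_semi (cx_rho c) n t).
Proof.
apply: bce_natural => x /=.
by rewrite (ms_res_comp (chm_E m) (ch_sub c') (subset_trans (ch_sub c') (chm_E m)))
  (ms_res_comp (ch_sub c) (chm_F m) (subset_trans (ch_sub c') (chm_E m))).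
Qed.
End Maps.

Lemma good_empty (c : chart) : (forall x, ~ oset (ch_E c) x) -> good c.
Proof.
move=> E0.
have F0 x : ~ oset (ch_F c) x by move/(ch_sub c); exact: E0.
have zE n (t : bc f (cx_E c n)) : t = 0.
  have [l ->] := bc_sum t; apply: big1 => p _.
  by rewrite [p.2](msec_empty (F := ir_term I n)) // bcpure0.
have zF n (t : cx_F c n) : t = 0 by exact: (msec_empty (F := ir_term I n)).
apply/cone_acyclicP; split=> [a _ _|a b _ _|n a b _ _]; first exact: zE.
  by exists 0; rewrite (zE _ a) (zF _ b) !raddf0.
by exists 0, 0; rewrite (zE _ a) (zF _ b) !raddf0 addr0.
Qed.

Hypothesis flatf : flat f.

Lemma good_min (c : chart) z w : min_open (ch_E c) z -> min_open (ch_F c) w ->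
  (forall t, bce (chart_rho c M) t = 0 -> t = 0) ->
  (forall y, exists t, bce (chart_rho c M) t = y) -> good c.
Proof.
move=> Ez Fw inj surj.
pose eA := bcm f (rs_lin (ch_a c) (ir_aug I (ch_E c) sT)).
pose eB := rs_lin (ch_b c) (ir_aug I (ch_F c) sT).
have augI V (s : M V) : ir_aug I V sT s = 0 -> s = 0.
  by move=> s0; apply: (ir_monic (i := I) (hV := sT)); rewrite s0 raddf0.
apply: (@resolution_cone_acyclic (bc_complex f (cx_E c)) (mc_forget (cx_F c))
  (bc_semi (cx_rho c)) _ _ eA eB (bce (chart_rho c M))) => //.
- by apply: bce_natural => x /=; rewrite (mh_natural (ir_aug I) _ sT).
- by apply: (bcm_exact flatf) => b db; exact: (exact_min Ez (ir_exact0 (i := I)) db).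
- by move=> n; apply: (bcm_exact flatf) => b db;
    exact: (exact_min Ez (ir_exactS (i := I) (n := n)) db).
- exact: augI.
- move=> t.
  apply: etrans (bcm0 (u := \0 : {linear mod_E c M -> mod_E c (ir_term I 1)}) _ t) => //.
  by apply: bcm_comp => x; exact: ir_d_aug.
- by move=> x dx; exact: (exact_min Fw (ir_exact0 (i := I)) dx).
- by move=> n x dx; exact: (exact_min Fw (ir_exactS (i := I) (n := n)) dx).
Qed.

Section MayerVietoris.
Variables (c c1 c2 c12 : chart).
Variables (m1 : chartMap c c1) (m2 : chartMap c c2).
Variables (n1 : chartMap c1 c12) (n2 : chartMap c2 c12).
Hypothesis coverE : forall x, oset (ch_E c) x -> oset (ch_E c1) x \/ oset (ch_E c2) x.
Hypothesis coverF : forall x, oset (ch_F c) x -> oset (ch_F c1) x \/ oset (ch_F c2) x.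
Hypothesis capE : forall x, oset (ch_E c1) x -> oset (ch_E c2) x -> oset (ch_E c12) x.
Hypothesis capF : forall x, oset (ch_F c1) x -> oset (ch_F c2) x -> oset (ch_F c12) x.

Lemma good_mv : good c1 -> good c2 -> good c12 -> good c.
Proof.
have fl n (U V : opens Z) (h : V `<=` U) (t : ir_term I n V) :
    exists s : ir_term I n U, ms_res h s = t.
  by apply: injective_flasque; exact: ir_injective.
suff sq : mv_square (cone_map (cx_map_rho m1)) (cone_map (cx_map_rho m2))
    (cone_map (cx_map_rho n1)) (cone_map (cx_map_rho n2)).
  exact: mv_acyclic sq.
apply: mv_cone.
- apply: (mv_bc flatf); split=> n /=.
  + exact: sections_mv_comm.
  + exact: sections_mv_inj coverE.
  + exact: sections_mv_glue coverE capE.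
  + exact: fl.
- split=> n /=.
  + exact: sections_mv_comm.
  + exact: sections_mv_inj coverF.
  + exact: sections_mv_glue coverF capF.
  + exact: fl.
Qed.
End MayerVietoris.
End Resolution.
End Charts.

Arguments ch_sub {k Z R S f} c.
Arguments chm_E {k Z R S f c c'} m : rename.
Arguments chm_F {k Z R S f c c'} m : rename.

(** * Base change along the product *)

Section TensorAlgebraBaseChange.
Variables (k R S B OE OF : comPzRingType).
Variables (i : {rmorphism k -> R}) (j : {rmorphism k -> S}) (g : {rmorphism k -> B}).
Variables (f : {rmorphism R -> S}) (fi : forall c, f (i c) = j c).
Variables (evE : {rmorphism OE -> tensalg i g}) (evF : {rmorphism OF -> tensalg j g}).
Hypotheses (evE_inj : injective evE) (evE_surj : forall t, exists c, evE c = t).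
Hypothesis evF_inj : injective evF.
Variables (ca : {rmorphism R -> OE}) (cb : {rmorphism S -> OF}).
Hypothesis evE_ca : forall r, evE (ca r) = purea i g r 1.
Hypothesis evF_cb : forall s, evF (cb s) = purea j g s 1.
Variable res : {rmorphism OE -> OF}.
Hypothesis evF_res : forall c a b,
  evE c = purea i g a b -> evF (res c) = purea j g (f a) b.
Variables (ME : lmodType OE) (MF : lmodType OF).
Variable rho :
  {linear restrict_scalars ca ME -> restrict_scalars f (restrict_scalars cb MF)}.
Local Notation rhoF m := (rho (m : restrict_scalars ca ME) : MF).
Hypothesis rhoZ : forall c (m : ME), rhoF (c *: m) = res c *: rhoF m.
Hypothesis span : forall m : MF,
  exists l : seq (OF * ME), m = \sum_(p <- l) p.1 *: rhoF p.2.
Hypothesis univ : forall (T : zmodType) (theta : OF -> ME -> T),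
  (forall s t m, theta (s + t) m = theta s m + theta t m) ->
  (forall s m n, theta s (m + n) = theta s m + theta s n) ->
  (forall s c m, theta (s * res c) m = theta s (c *: m)) ->
  exists psi : {additive MF -> T}, forall s m, psi (s *: rhoF m) = theta s m.

Local Notation T := (bc f (restrict_scalars ca ME)).
Local Notation "s '%x' m" := (bcpure f s (m : restrict_scalars ca ME)) (at level 40).

Let sec (b : B) : OE := projT1 (cid (evE_surj (purea i g 1 b))).
Let secE b : evE (sec b) = purea i g 1 b.
Proof. by rewrite /sec; case: cid. Qed.
Let secD b b' : sec (b + b') = sec b + sec b'.
Proof. by apply: evE_inj; rewrite rmorphD !secE pureaDr. Qed.
Let secM b b' : sec (b * b') = sec b * sec b'.
Proof. by apply: evE_inj; rewrite rmorphM !secE pureaM mulr1. Qed.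
Let secZ c b : sec (g c * b) = ca (i c) * sec b.
Proof.
apply: evE_inj; rewrite rmorphM !secE evE_ca pureaM mul1r mulr1.
by rewrite -[in RHS](mulr1 (i c)) pureaZ.
Qed.

Let ca_secE a b : evE (ca a * sec b) = purea i g a b.
Proof. by rewrite rmorphM evE_ca secE pureaM mulr1 mul1r. Qed.

Let ca_scale r (m : ME) s : s %x (ca r *: m) = (s * f r) %x m.
Proof. exact: (bcpureZ f s r (m : restrict_scalars ca ME)). Qed.

(** The action of S (x)_k B on S (x)_R ME, applied to 1 (x) m: S acts on the left factor and B on ME
    through OE. It supplies the pairing from which [univ] builds the inverse of the base change
    map. *)
Let Theta_ex (m : ME) : exists Th : {additive tensalg j g -> T},
  forall s b, Th (purea j g s b) = s %x (sec b *: m).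
Proof.
pose bl (s : restrict_scalars j S^o) (b : restrict_scalars g B^o) :
  restrict_scalars i T := (s : S) %x (sec b *: m).
have bil : is_bilinear bl.
  split=> [s t b|s b b'|c s b|c s b]; rewrite /bl.
  - exact: bcpureDl.
  - by rewrite secD scalerDl; exact: bcpureDr.
  - case: (bcpure_bil f (restrict_scalars ca ME)) => _ _ h3 _.
    apply: etrans (h3 (i c) s _).
    suff e : j c * (s : S) = f (i c) * (s : S)
      by exact: (congr1 (fun x => x %x (sec b *: m)) e).
    by rewrite fi.
  - case: (bcpure_bil f (restrict_scalars ca ME)) => _ _ _ h4.
    apply: etrans (h4 (i c) s _).
    suff e : sec (g c * (b : B)) *: m = ca (i c) *: (sec b *: m)
      by exact: (congr1 (fun n => s %x n) e).
    by rewrite secZ scalerA.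
have D : {morph (tens_lift bl : tensalg j g -> T) : x y / x + y}.
  exact: (tens_liftD bil).
by exists (additive_of D) => s b; exact: (tens_lift_pure _ _ bil).
Qed.
Let Theta m := projT1 (cid (Theta_ex m)).
Let ThetaE m s b : Theta m (purea j g s b) = s %x (sec b *: m).
Proof. by rewrite /Theta; case: cid. Qed.

Let ThetaD m n t : Theta (m + n) t = Theta m t + Theta n t.
Proof.
move: t; apply: (tensalg_ext (h := Theta (m + n)) (h' := Theta m \+ Theta n)) => s b /=.
by rewrite !ThetaE scalerDr; exact: bcpureDr.
Qed.

(** Balancedness over OE, as [univ] requires. Both sides are additive in c and t, and OE is
    additively generated by the products [ca a * sec b]. *)
Let Theta_res t c m : Theta m (t * evF (res c)) = Theta (c *: m) t.
Proof.
have ThD t' : {morph (fun c => Theta m (t' * evF (res c))) : x y / x + y}.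
  by move=> x y; rewrite !rmorphD mulrDr raddfD.
have ThD' t' : {morph (fun c => Theta (c *: m) t') : x y / x + y}.
  by move=> x y; rewrite scalerDl ThetaD.
have -> : c = \sum_(p <- repr (evE c : tens _ _)) ca p.1 * sec p.2.
  apply: evE_inj; rewrite {1}[evE c]purea_sum raddf_sum; apply: eq_bigr => p _.
  by apply/esym; exact: ca_secE.
rewrite -[LHS]/(additive_of (ThD t) _) -[RHS]/(additive_of (ThD' t) _) !raddf_sum.
apply: eq_bigr => -[a b'] _ /=.
have ThM t' : {morph (fun t => Theta m (t * t')) : x y / x + y}.
  by move=> x y; rewrite mulrDl raddfD.
move: t; apply: (tensalg_ext (h := additive_of (ThM _)) (h' := Theta _)) => s b /=.
rewrite (evF_res (ca_secE a b')).
by rewrite pureaM !ThetaE -ca_scale secM !scalerA mulrCA mulrA.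
Qed.

(** Since S (x)_R (R (x)_k B) = S (x)_k B, base change of ME along R -> S is base change along OE ->
    OF, and [span] and [univ] say that the latter yields MF. *)
Lemma tensalg_base_change :
  (forall t, bce rho t = 0 -> t = 0) /\ (forall y, exists t, bce rho t = y).
Proof.
split=> [t rt|y].
  have [|||psi psiE] := @univ T (fun s m => Theta m (evF s)).
  - by move=> s s' m; rewrite rmorphD raddfD.
  - by move=> s m n; exact: ThetaD.
  - by move=> s c m; rewrite rmorphM; exact: Theta_res.
  have <- : psi (bce rho t) = t.
    move: t {rt}; apply: (bc_ext (h := psi \o bce rho) (h' := idfun)) => s m /=.
    rewrite bceE; apply: etrans (psiE (cb s) m) _.
    rewrite evF_cb ThetaE (_ : sec 1 = 1) ?scale1r //.
    by apply: evE_inj; rewrite secE rmorph1.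
  by rewrite rt raddf0.
have [l ->] := span y; elim: l => [|[s m] l [t tE]].
  by exists 0; rewrite big_nil raddf0.
rewrite big_cons /= -tE.
suff [t' <-] : exists t', bce rho t' = s *: rhoF m by exists (t' + t); rewrite raddfD.
(* The B-part of a scalar of OF comes from OE, so it can be moved onto [m], leaving scalars from S
   only. *)
have -> : s = \sum_(p <- repr (evF s : tens _ _)) cb p.1 * res (sec p.2).
  apply: evF_inj; rewrite {1}[evF s]purea_sum raddf_sum; apply: eq_bigr => p _.
  apply/esym; apply: etrans (rmorphM _ _ _) _.
  by rewrite evF_cb (evF_res (secE _)) rmorph1 pureaM mulr1 mul1r.
exists (\sum_(p <- repr (evF s : tens _ _)) p.1 %x (sec p.2 *: m)).
rewrite raddf_sum scaler_suml; apply: eq_bigr => p _.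
rewrite bceE; apply: etrans (congr1 (fun y : MF => cb p.1 *: y) (rhoZ _ _)) _.
exact: (@scalerA OF MF).
Qed.
End TensorAlgebraBaseChange.

Lemma min_nbhs_nbhs (Y : topologicalType) (p : Y) (A : set Y) :
  nbhs p A -> min_nbhs p `<=` A.
Proof.
rewrite nbhsE => -[U [oU Up] UA]; apply: subset_trans UA.
exact: min_nbhs_sub.
Qed.

Lemma min_nbhs_prod (Y Y' : topologicalType) (z w : Y * Y') :
  min_nbhs z.1 w.1 -> min_nbhs z.2 w.2 -> min_nbhs z w.
Proof.
move=> w1 w2 U [oU Uz].
have : nbhs z U by apply: open_nbhs_nbhs.
move=> [[A A'] /= [nA nA'] AU]; apply: (AU w); split.
  exact: min_nbhs_nbhs nA _ w1.
exact: min_nbhs_nbhs nA' _ w2.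
Qed.

(** * Induction on the open subsets of a finite space *)

Section OpenInduction.
Variables (k : comPzRingType) (Y : ringedFiniteSpace k) (Q : opens Y -> Prop).
Hypothesis Q_empty : forall W : opens Y, (forall y, ~ oset W y) -> Q W.
Hypothesis Q_min : forall (W : opens Y) y, min_open W y -> Q W.
Hypothesis Q_union : forall W W1 W2 W12 : opens Y,
  (forall y, oset W y <-> oset W1 y \/ oset W2 y) ->
  (forall y, oset W12 y <-> oset W1 y /\ oset W2 y) ->
  Q W1 -> Q W2 -> Q W12 -> Q W.

Let finW (W : opens Y) : finite_set (oset W).
Proof. exact: sub_finite_set (@subsetT _ _) (rfs_finite Y). Qed.

Let in_fsetW (W : opens Y) y : y \in fset_set (oset W) <-> oset W y.
Proof. by rewrite in_fset_set //; split=> [/set_mem|/mem_set]. Qed.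

Lemma open_induction (W : opens Y) : Q W.
Proof.
have [n] := ubnP #|` fset_set (oset W)|; elim: n W => // n IH W Wn.
have [[y [Wy Wmin]]|nmin] := pselect (exists y, oset W y /\ W `<=` min_nbhs y).
  exact: (@Q_min W y).
(* A union of minimal neighbourhoods meets U_x in a proper open subset of W, to
   which the induction hypothesis applies. *)
have cov (l : seq Y) : (forall y, y \in l -> oset W y) ->
    forall V : opens Y, (forall y, oset V y <-> exists2 x, x \in l & min_nbhs x y) -> Q V.
  elim: l => [_ V VE|x l IHl lW V VE].
    by apply: Q_empty => y /VE[].
  have oV' : open (\bigcup_(x in [set` l]) min_nbhs x).
    by apply: bigcup_open => x' _; apply: min_nbhs_open; exact: rfs_finite.
  pose V' := Opens oV'.
  have VU : forall y, oset V y <-> oset (Umin x) y \/ oset V' y.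
    move=> y; rewrite VE; split=> [[x']|[xy|[x' /= x'l x'y]]].
    - by rewrite inE => /predU1P[->|x'l] x'y; [left|right; exists x'].
    - by exists x; rewrite ?mem_head.
    - by exists x'; rewrite // inE x'l orbT.
  pose V12 := Opens (openI (oset_open (Umin x)) (oset_open V')).
  apply: (Q_union (W12 := V12) VU) => //.
  - exact: Q_min (Umin_min_open x).
  - by apply: IHl => [y yl|y]; [apply: lW; rewrite inE yl orbT|split=> -[x' ? ?]; exists x'].
  - have Wx : oset W x by apply: lW; rewrite mem_head.
    apply: IH; move: Wn; rewrite ltnS; apply: leq_trans; apply: fproper_ltn_card.
    have [y Wy nxy] : exists2 y, oset W y & ~ min_nbhs x y.
      apply: contrapT => nW; apply: nmin; exists x; split=> // y Wy.
      by apply: contrapT => nxy; apply: nW; exists y.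
    rewrite fproperE; apply/andP; split.
      by apply/fsubsetP => v /in_fsetW[xv _]; apply/in_fsetW; exact: Umin_sub xv.
    apply/negP => /fsubsetP/(_ y) WV; apply: nxy.
    by have /WV/in_fsetW[] : y \in fset_set (oset W) by apply/in_fsetW.
apply: (cov (fset_set (oset W))) => [y|y]; first by move/in_fsetW.
split=> [Wy|[x /in_fsetW Wx]]; last exact: Umin_sub.
by exists y; [apply/in_fsetW|exact: min_nbhs_self].
Qed.
End OpenInduction.

(** * The projection *)

Section StalkEval.
Variables (Z : topologicalType) (A : stalkData Z) (U : opens Z) (z : Z) (Uz : oset U z).
Definition stalk_eval (s : stalkSec A U) : A z := s z Uz.
Let stalk_eval_zmod : zmod_morphism stalk_eval. Proof. by []. Qed.
Let stalk_eval_monoid : monoid_morphism stalk_eval. Proof. by []. Qed.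
HB.instance Definition _ := GRing.isZmodMorphism.Build _ _ stalk_eval stalk_eval_zmod.
HB.instance Definition _ := GRing.isMonoidMorphism.Build _ _ stalk_eval stalk_eval_monoid.
Definition stalk_eval_rmorphism : {rmorphism stalkSec A U -> A z} := stalk_eval.
End StalkEval.

Section Projection.
Variables (k : comPzRingType) (X X' : ringedFiniteSpace k).
Local Notation P := (prod_space X X').
Local Notation pi := (prod_proj X X').
Local Notation pre := (opre (rm_continuous pi)).
Variables (M : modSheaf P) (qcM : quasi_coherent M) (I : injectiveResolution M).

Section Stalks.
Variables (p q : X) (h : Umin q `<=` Umin p).
Hypothesis flath : flat (rs_res h).

Definition proj_chart : chart P (rs_res h) :=
  @Chart k P (stalk p) (stalk q) (rs_res h) (pre (Umin p)) (pre (Umin q)) (pre_sub h)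
    (rm_sharp pi (Umin p)) (rm_sharp pi (Umin q)) (fun r => rm_natural h (pre_sub h) r).

(** The open sets of [c] are the minimal neighbourhoods of (p, x') and (q, x'), so evaluation there
    identifies their rings with the tensor products of stalks, and quasi-coherence provides the
    generators and the universal property that [tensalg_base_change] asks for. *)
Lemma good_proj_min (c : chart P (rs_res h)) (m : chartMap proj_chart c) (W : opens X') x' :
  min_open W x' ->
  (forall z, oset (ch_E c) z <-> oset (Umin p) z.1 /\ oset W z.2) ->
  (forall z, oset (ch_F c) z <-> oset (Umin q) z.1 /\ oset W z.2) -> good I c.
Proof.
move=> [Wx Wmin] cE cF.
have Ez : oset (ch_E c) (p, x') by apply/cE; split=> //; exact: min_nbhs_self.
have Fw : oset (ch_F c) (q, x') by apply/cF; split=> //; exact: min_nbhs_self.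
have Em : min_open (ch_E c) (p, x').
  by split=> // z /cE[z1 z2]; apply: min_nbhs_prod => //; exact: Wmin.
have Fm : min_open (ch_F c) (q, x').
  by split=> // z /cF[z1 z2]; apply: min_nbhs_prod => //; exact: Wmin.
pose evE : {rmorphism rs_sec P (ch_E c) -> tensalg (stalk_base p) (stalk_base x')} :=
  stalk_eval_rmorphism (prod_data X X') Ez.
pose evF : {rmorphism rs_sec P (ch_F c) -> tensalg (stalk_base q) (stalk_base x')} :=
  stalk_eval_rmorphism (prod_data X X') Fw.
have fi r : rs_res h (stalk_base p r) = stalk_base q r by exact: rs_res_comp.
have evEb : bijective evE := stalk_spaceE (prod_data X X') Ez (proj2 Em).
have evFb : bijective evF := stalk_spaceE (prod_data X X') Fw (proj2 Fm).
have evEs t : exists s, evE s = t by case: evEb => e _ eK; exists (e t).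
have [||||||inj surj] := @tensalg_base_change k (stalk p) (stalk q) (stalk x') _ _
  (stalk_base p) (stalk_base q) (stalk_base x') (rs_res h) fi evE evF
  (bij_inj evEb) evEs (bij_inj evFb) (ch_a c) (ch_b c) _ _ (rs_res (ch_sub c)) _
  (M (ch_E c)) (M (ch_F c)) (chart_rho c M).
- move=> r; rewrite -(chm_a m).
  have e := rs_res_id (min_nbhs_sub (oset_open (Umin p)) (chm_E m _ Ez) : Umin p `<=` Umin p) r.
  exact: (congr1 (fun a => purea (stalk_base p) (stalk_base x') a 1) e).
- move=> s; rewrite -(chm_b m).
  have e := rs_res_id (min_nbhs_sub (oset_open (Umin q)) (chm_F m _ Fw) : Umin q `<=` Umin q) s.
  exact: (congr1 (fun a => purea (stalk_base q) (stalk_base x') a 1) e).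
(* The value at (q, x') is the image of the value at (p, x'), and the map between these stalks is
   the identity on the factor at x'. *)
- move=> s a b sE.
  have zw : spec_le ((p, x') : X * X') (q, x').
    by apply: min_nbhs_prod; [apply: h; exact: min_nbhs_self|exact: min_nbhs_self].
  have := ss_compat (s : stalkSec (prod_data X X') (ch_E c)) Ez (ch_sub c _ Fw) zw.
  rewrite [X in sd_map _ _ X](sE : (s : stalkSec _ _) (p, x') Ez = _).
  move=> e; apply: etrans (esym e) _; apply: etrans (tensalg_map_pure _ _ _ _) _.
  congr purea; last exact: rs_res_id.
  by rewrite /stalk_map; congr (rs_res _ _); exact: Prop_irrelevance.
- exact: ms_resZ.
- move=> y; have H := qc_span qcM Em Fm (ch_sub c) y. exact: H.
- move=> T theta t1 t2 t3. have H := qc_universal qcM Em Fm t1 t2 t3. exact: H.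
exact: (good_min I flath Em Fm).
Qed.

Lemma good_proj_chart : good I proj_chart.
Proof.
(* All charts with the right points are considered, so that the product open sets are needed only up
   to extensional equality. *)
pose Q (W : opens X') := forall c : chart P (rs_res h), chartMap proj_chart c ->
  (forall z, oset (ch_E c) z <-> oset (Umin p) z.1 /\ oset W z.2) ->
  (forall z, oset (ch_F c) z <-> oset (Umin q) z.1 /\ oset W z.2) -> good I c.
suff : Q (oT X').
  apply; first by exists (@subset_refl _ _) (@subset_refl _ _) => x; exact: rs_res_id.
    by move=> z; split=> [|[]].
  by move=> z; split=> [|[]].
apply: (open_induction (Q := Q)); rewrite /Q => {Q}.
- by move=> W W0 c _ cE _; apply: good_empty => z /cE[_ /W0].
- by move=> W x' Wm c m cE cF; exact: (good_proj_min m Wm cE cF).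
move=> W W1 W2 W12 WU WI Q1 Q2 Q12 c m cE cF.
have sub (V : opens X') : V `<=` W -> exists c' : chart P (rs_res h),
  [/\ inhabited (chartMap c c'),
      forall z, oset (ch_E c') z <-> oset (Umin p) z.1 /\ oset V z.2 &
      forall z, oset (ch_F c') z <-> oset (Umin q) z.1 /\ oset V z.2].
  move=> VW.
  have oV : open (@snd X X' @^-1` V).
    by apply: open_comp; [move=> z _; exact: cvg_snd|exact: oset_open].
  pose E' : opens P := Opens (openI (oset_open (ch_E c)) oV).
  pose F' : opens P := Opens (openI (oset_open (ch_F c)) oV).
  have [|||c' [c'E c'F mm]] := @restrict_chart _ _ _ _ _ c E' F'.
  - by move=> z [].
  - by move=> z [].
  - by move=> z [/(ch_sub c) ? ?]; split.
  exists c'; rewrite c'E c'F; split => // z.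
    by split=> [[/cE[]]|[z1 z2]]; [|split=> //; apply/cE; split=> //; exact: VW].
  by split=> [[/cF[]]|[z1 z2]]; [|split=> //; apply/cF; split=> //; exact: VW].
have W1W : W1 `<=` W by move=> y W1y; apply/WU; left.
have W2W : W2 `<=` W by move=> y W2y; apply/WU; right.
have [c1 [[m1] c1E c1F]] := sub W1 W1W; have [c2 [[m2] c2E c2F]] := sub W2 W2W.
have [|c12 [[m12] c12E c12F]] := sub W12; first by move=> y /WI[/W1W].
have n1 : chartMap c1 c12.
  apply: (chart_map_factor m1 m12) => z.
    by move=> /c12E[zp /WI[z1 z2]]; apply/c1E.
  by move=> /c12F[zp /WI[z1 z2]]; apply/c1F.
have n2 : chartMap c2 c12.
  apply: (chart_map_factor m2 m12) => z.
    by move=> /c12E[zp /WI[z1 z2]]; apply/c2E.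
  by move=> /c12F[zp /WI[z1 z2]]; apply/c2F.
apply: (good_mv flath m1 m2 n1 n2).
- by move=> z /cE[zp /WU[zW|zW]]; [left; apply/c1E|right; apply/c2E].
- by move=> z /cF[zp /WU[zW|zW]]; [left; apply/c1F|right; apply/c2F].
- by move=> z /c1E[zp z1] /c2E[_ z2]; apply/c12E; split=> //; apply/WI.
- by move=> z /c1F[zp z1] /c2F[_ z2]; apply/c12F; split=> //; apply/WI.
- by apply: Q1 c1E c1F; exact: chart_map_trans m m1.
- by apply: Q2 c2E c2F; exact: chart_map_trans m m2.
- by apply: Q12 c12E c12F; exact: chart_map_trans m m12.
Qed.

End Stalks.

Section CohomologySheaf.
Hypothesis flatX : finite_space X.

Lemma flat_res (p q : X) (h : Umin q `<=` Umin p) : flat (rs_res h).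
Proof.
have pq : spec_le p q by apply: h; exact: min_nbhs_self.
by rewrite (Prop_irrelevance h (spec_leP pq)); exact: flatX.
Qed.

(** The sections over U_p of the pushed-forward resolution form the complex of [proj_chart], and
    minimality of U_p turns the kernel of sheaves into a kernel of modules. *)
Lemma kernel_base_change_iso (N : modSheaf X) :
  is_kernel (pushforward_hom pi (ir_d I 0%N)) N ->
  forall (p q : X) (h : Umin q `<=` Umin p), base_change_iso N h.
Proof.
move=> [j [j1 jex]] p q h.
have pm := Umin_min_open p; have qm := Umin_min_open q.
have fl : flat (rs_res h) by exact: flat_res.
apply: (kernel_base_change fl (good_proj_chart fl)
  (j := j (Umin p) (@subsetT _ _)) (j' := j (Umin q) (@subsetT _ _))) => x.
- exact: monic_eq0 j1.
- exact: exact_minP pm jex.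
- exact: monic_eq0 j1.
- exact: exact_minP qm jex.
- have H := mh_natural j (@subsetT _ _) (@subsetT _ _) h x; exact: H.
Qed.

Lemma cohomology_base_change_iso n (N : modSheaf X) :
  is_cohomology (pushforward_hom pi (ir_d I n)) (pushforward_hom pi (ir_d I n.+1)) N ->
  forall (p q : X) (h : Umin q `<=` Umin p), base_change_iso N h.
Proof.
move=> [K [j [a [pr [j1 jex ja aex prs]]]]] p q h.
have pm := Umin_min_open p; have qm := Umin_min_open q.
have fl : flat (rs_res h) by exact: flat_res.
apply: (cohomology_base_change fl (good_proj_chart fl)
  (rK := res_lin K h)
  (j := j (Umin p) (@subsetT _ _)) (j' := j (Umin q) (@subsetT _ _))
  (a := a (Umin p) (@subsetT _ _)) (a' := a (Umin q) (@subsetT _ _))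
  (p := pr (Umin p) (@subsetT _ _)) (p' := pr (Umin q) (@subsetT _ _))) => x.
- exact: monic_eq0 j1.
- exact: exact_minP pm jex.
- exact: monic_eq0 j1.
- exact: exact_minP qm jex.
- exact: ja.
- exact: ja.
- exact: exact_minP pm aex.
- exact: epi_min pm prs.
- exact: exact_minP qm aex.
- exact: epi_min qm prs.
- have H := mh_natural j (@subsetT _ _) (@subsetT _ _) h x; exact: H.
- have H := mh_natural pr (@subsetT _ _) (@subsetT _ _) h x; exact: H.
Qed.
End CohomologySheaf.
End Projection.

Theorem theorem3p5 (k : comPzRingType) (X X' : ringedFiniteSpace k)
    (flatX : finite_space X)
    (M : modSheaf (prod_space X X')) (qcM : quasi_coherent M)
    (i : nat) (N : modSheaf X)
    (RN : is_higher_direct_image (prod_proj X X') i M N) :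
  quasi_coherent N.
Proof.
apply: base_change_quasi_coherent => p q h; case: RN => I; case: i => [|n].
  by move=> /kernel_base_change_iso; apply.
by move=> /cohomology_base_change_iso; apply.
Qed.
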